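(* Let $(\rho,m)$ be a smooth solution on $[0,T]$ of the compressible network flow problem (F1)--(F6) defined in the context, with initial values $\rho(0)=\rho_0$ and $m(0)=m_0$. Then, for all $0\le t\le T$, $$\int_{\mathcal E}\rho(t)\,dx=\int_{\mathcal E}\rho_0\,dx$$ and $$\int_{\mathcal E}\Big(\frac{m(t)^2}{2\rho(t)}+P(\rho(t))\Big)dx+\int_0^t\int_{\mathcal E}\Big(a\frac{|\partial_x'm(s)|^2}{|\rho(s)|^2}+b\frac{|m(s)|^3}{|\rho(s)|^2}\Big)dx\,ds=\int_{\mathcal E}\Big(\frac{m_0^2}{2\rho_0}+P(\rho_0)\Big)dx.$$
   Context: Network. $\mathcal G=(\mathcal V,\mathcal E,\ell)$ is a finite, directed, connected graph with vertex set $\mathcal V$, edge set $\mathcal E\subset\mathcal V\times\mathcal V$, and lengths $\ell_e>0$, $e\in\mathcal E$. An edge $e=(v_1,v_2)$ is identified with the interval $[0,\ell_e]$ ($v_1$ corresponding to $0$, $v_2$ to $\ell_e$), and $n_e(v_1)=-1$, $n_e(v_2)=1$. $\mathcal E(v)$ is the set of edges incident on $v$; $\mathcal V_0=\{v:|\mathcal E(v)|\ge2\}$ are the inner vertices, $\mathcal V_\partial=\mathcal V\setminus\mathcal V_0$ the boundary vertices. Function spaces. For a function $u$ on the network, $u_e=u|_e$. $L^2(\mathcal E)$, $L^\infty(\mathcal E)$, $H^s(\mathcal E)$ are the spaces of functions with $u_e\in L^2(e)$, $L^\infty(e)$, $H^s(e)$, respectively, for every $e$ (no continuity at vertices). $\int_{\mathcal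 E}u\,dx=\sum_e\int_0^{\ell_e}u_e\,dx$. The broken derivative $\partial_x'u$ is $(\partial_x'u)|_e=\partial_x(u_e)$. $u_e(v)$ is the value of $u_e$ at the endpoint $v$. $H^1_+(\mathcal E)=\{\rho\in H^1(\mathcal E):\exists\,\underline\rho>0,\ \rho\ge\underline\rho\text{ a.e. on }\mathcal E\}$. Data. $a_e,b_e\ge0$ and $c_e>0$ are constants on each edge and $a,b$ denote the edgewise constant functions with values $a_e,b_e$; $\gamma>1$; $p_e(\rho)=c_e\rho^\gamma$, $P_e(\rho)=\frac{c_e}{\gamma-1}\rho^\gamma$; $P(\rho)$ denotes the function with restriction $P_e(\rho_e)$ to $e$. Flow problem: (F1) $\partial_t\rho_e+\partial_xm_e=0$ for all $e\in\mathcal E$; (F2) $\partial_tm_e+\partial_x\big(\frac{m_e^2}{\rho_e}+p_e(\rho_e)\big)=a_e\rho_e\,\partial_x\big(\frac1{\rho_e^2}\partial_xm_e\big)-b_e\frac{|m_e|m_e}{\rho_e}$ for all $e\in\mathcal E$; (F3) $p_e(\rho)=c_e\rho^\gamma$ and $P_e(\rho)=\frac{c_e}{\gamma-1}\rho^\gamma$ for all $e\in\mathcal E$; (F4) $\sum_{e\in\mathcal E(v)}m_e(v)n_e(v)=0$ for all $v\in\mathcal V_0$; (F5) for every $v\in\mathcal V_0$ there is a value $h_v$ (depending on time but not on $e$) with $\frac{m_e(v)^2}{2\rho_e(v)^2}+P_e'(\rho_e(v))=h_v+\frac{a_e}{\rho_e(v)^2}\partial_xm_e(v)$ for all $e\in\mathcal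 E(v)$; (F6) $m_e(v)n_e(v)=0$ for all $v\in\mathcal V_\partial$, $e\in\mathcal E(v)$. A smooth solution on $[0,T]$ is a pair $(\rho,m)\in C^1([0,T];L^\infty(\mathcal E)\times L^2(\mathcal E))\cap C([0,T];H^1_+(\mathcal E)\times H^2(\mathcal E))$ satisfying these equations for all $t>0$ (i.e. $0<t\le T$) and a.e. on $\mathcal E$. *)

(* Defs.v *)
From HB Require Import structures.
From mathcomp Require Import all_boot all_order all_algebra.
From mathcomp Require Import all_classical all_reals all_analysis.
Set Implicit Arguments.
Unset Strict Implicit.
Unset Printing Implicit Defensive.
Import Order.TTheory GRing.Theory Num.Theory.
Import numFieldNormedType.Exports.
Local Open Scope classical_set_scope.
Local Open Scope ring_scope.

(** Weak derivatives and traces on an interval [0, l].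
    Elements of Lebesgue and Sobolev spaces are represented by functions
    [R -> R]; only their values on [0, l], up to null sets, are relevant. *)

(* The test functions C^1_c(0, l). The support is closed in R and contained in
   the bounded interval ]0, l[, hence it is compact. Testing with C^1_c or with
   C^oo_c gives the same weak derivatives. *)
Definition test_function (R : realType) (l : R) (phi : R -> R) : Prop :=
  [/\ forall x, derivable phi x 1,
      continuous (derive1 phi) &
      closure [set x | phi x != 0] `<=` `]0, l[].

Definition is_wderiv (R : realType) (l : R) (u g : R -> R) : Prop :=
  [/\ locally_integrable `]0, l[ u,
      locally_integrable `]0, l[ g &
      forall phi, test_function l phi ->
        (\int[lebesgue_measure]_(x in `]0%R, l[) (u x * derive1 phi x) =
         - \int[lebesgue_measure]_(x in `]0%R, l[) (g x * phi x))%R].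

(* The weak derivative, unique up to a null set; an arbitrary function if [u]
   is not weakly differentiable. *)
Definition wderiv (R : realType) (l : R) (u : R -> R) : R -> R :=
  xget (cst 0) [set g | is_wderiv l u g].

(* The representative of [u] continuous up to the end points; it is unique on
   [0, l], and it exists for every [u] in H^1(0, l). *)
Definition continuous_rep (R : realType) (l : R) (u : R -> R) : R -> R :=
  xget (cst 0) [set v | {within `[0, l], continuous v} /\
                        \forall x \ae lebesgue_measure, x \in `[0, l] -> v x = u x].

(** Networks *)

(* The absence of loops is what makes [normal e v] and [u_e(v)] meaningful;
   connectedness is that of the underlying undirected graph. *)
Record network (R : realType) := Network {
  vertex : finType ;
  edges : {set vertex * vertex} ;
  len : {e : vertex * vertex | e \in edges} -> R ;
  len_gt0 : forall e, 0 < len e ;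
  edge_loopless : forall v, (v, v) \notin edges ;
  net_connected : forall v w,
    connect [rel x y | ((x, y) \in edges) || ((y, x) \in edges)] v w }.

Definition edge (R : realType) (G : network R) : finType :=
  {e : vertex G * vertex G | e \in edges G}.

Definition source (R : realType) (G : network R) (e : edge G) : vertex G :=
  (val e).1.

Definition target (R : realType) (G : network R) (e : edge G) : vertex G :=
  (val e).2.

Definition incident (R : realType) (G : network R) (v : vertex G) :
    {set edge G} :=
  [set e | (source e == v) || (target e == v)]%SET.

Definition inner (R : realType) (G : network R) (v : vertex G) : bool :=
  (2 <= #|incident v|)%N.

Definition normal (R : realType) (G : network R) (e : edge G) (v : vertex G) :
    R :=
  if v == source e then -1 else if v == target e then 1 else 0.

(* The coordinate in [0, len e] of the end point [v] of [e]. *)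
Definition coord (R : realType) (G : network R) (e : edge G) (v : vertex G) :
    R :=
  if v == source e then 0 else len e.

(** Functions on a network *)

Definition netfun (R : realType) (G : network R) := edge G -> R -> R.

Definition trace (R : realType) (G : network R) (u : netfun G) (e : edge G)
    (v : vertex G) : R :=
  continuous_rep (len e) (u e) (coord e v).

Definition dx (R : realType) (G : network R) (u : netfun G) : netfun G :=
  fun e => wderiv (len e) (u e).

Definition net_integral (R : realType) (G : network R) (u : netfun G) : R :=
  \sum_e (\int[lebesgue_measure]_(x in `[0%R, len e]) u e x)%R.

Definition net_ae (R : realType) (G : network R) (P : edge G -> R -> Prop) :
    Prop :=
  forall e, \forall x \ae lebesgue_measure, x \in `[0, len e] -> P e x.

Definition in_Lp (R : realType) (G : network R) (p : \bar R) (u : netfun G) :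
    Prop :=
  forall e, u e \_ `[0, len e] \in Lfun lebesgue_measure p.

Definition in_H1 (R : realType) (G : network R) (u : netfun G) : Prop :=
  in_Lp 2%:E u /\
  exists2 g : netfun G, in_Lp 2%:E g &
    forall e, is_wderiv (len e) (u e) (g e).

Definition in_H2 (R : realType) (G : network R) (u : netfun G) : Prop :=
  in_H1 u /\ in_H1 (dx u).

Definition in_H1plus (R : realType) (G : network R) (u : netfun G) : Prop :=
  in_H1 u /\ exists2 r : R, 0 < r & net_ae (fun e x => r <= u e x).

Definition edge_norm (R : realType) (G : network R) (p : \bar R)
    (u : netfun G) (e : edge G) : \bar R :=
  'N[lebesgue_measure]_p[EFin \o (u e \_ `[0, len e])].

Definition norm_Loo (R : realType) (G : network R) (u : netfun G) : \bar R :=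
  \big[maxe/0%E]_e edge_norm +oo u e.

Definition norm_L2 (R : realType) (G : network R) (u : netfun G) : \bar R :=
  ((\sum_e edge_norm 2%:E u e `^ 2) `^ 2^-1)%E.

Definition norm_H1 (R : realType) (G : network R) (u : netfun G) : \bar R :=
  ((norm_L2 u `^ 2 + norm_L2 (dx u) `^ 2) `^ 2^-1)%E.

Definition norm_H2 (R : realType) (G : network R) (u : netfun G) : \bar R :=
  ((norm_L2 u `^ 2 + norm_L2 (dx u) `^ 2 + norm_L2 (dx (dx u)) `^ 2) `^ 2^-1)%E.

(** Time dependent functions on a network, regarded as maps from [0, T] to the
    space of the functions satisfying [X], with norm [N] *)

Definition C0_in (R : realType) (G : network R) (X : netfun G -> Prop)
    (N : netfun G -> \bar R) (T : R) (u : R -> netfun G) : Prop :=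
  (forall t, t \in `[0, T] -> X (u t)) /\
  (forall t, t \in `[0, T] ->
     N (fun e x => u s e x - u t e x) @[s --> within `[0, T] (nbhs t)]
       --> 0%E).

(* [u] is in C^1([0, T]; X) and [du] is its derivative; the difference quotients
   are one-sided at the end points of [0, T]. *)
Definition C1_in (R : realType) (G : network R) (X : netfun G -> Prop)
    (N : netfun G -> \bar R) (T : R) (u du : R -> netfun G) : Prop :=
  [/\ C0_in X N T u,
      C0_in X N T du &
      forall t, t \in `[0, T] ->
        N (fun e x => (u s e x - u t e x) / (s - t) - du t e x)
          @[s --> within `[0, T] (dnbhs t)] --> 0%E].

(** The flow problem *)

Definition pressure (R : realType) (G : network R) (c : edge G -> R) (gamma : R)
    (e : edge G) (r : R) : R :=
  c e * r `^ gamma.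

Definition potential (R : realType) (G : network R) (c : edge G -> R)
    (gamma : R) (e : edge G) (r : R) : R :=
  c e / (gamma - 1) * r `^ gamma.

(* The equations at a fixed time; [drho] and [dm] are the values of the time
   derivatives of [rho] and [m]. *)
Record flow_equations (R : realType) (G : network R) (a b c : edge G -> R)
    (gamma : R) (rho m drho dm : netfun G) : Prop := FlowEquations {
  mass_balance : net_ae (fun e x => drho e x + dx m e x = 0) ;
  momentum_balance : net_ae (fun e x =>
    dm e x +
    dx (fun e x => m e x ^+ 2 / rho e x + pressure c gamma e (rho e x)) e x =
    a e * rho e x * dx (fun e x => 1 / rho e x ^+ 2 * dx m e x) e x -
    b e * (`|m e x| * m e x / rho e x)) ;
  junction_mass : forall v : vertex G, inner v ->
    \sum_(e in incident v) trace m e v * normal e v = 0 ;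
  junction_energy : forall v : vertex G, inner v ->
    exists h : R, forall e : edge G, e \in incident v ->
      trace m e v ^+ 2 / (2 * trace rho e v ^+ 2) +
      derive1 (potential c gamma e) (trace rho e v) =
      h + a e / trace rho e v ^+ 2 * trace (dx m) e v ;
  boundary_flux : forall v : vertex G, ~~ inner v ->
    forall e : edge G, e \in incident v -> trace m e v * normal e v = 0 }.

Definition smooth_solution (R : realType) (G : network R)
    (a b c : edge G -> R) (gamma T : R) (rho m : R -> netfun G) : Prop :=
  exists drho dm : R -> netfun G,
  [/\ C1_in (@in_Lp R G +oo) (@norm_Loo R G) T rho drho,
      C1_in (@in_Lp R G 2%:E) (@norm_L2 R G) T m dm,
      C0_in (@in_H1plus R G) (@norm_H1 R G) T rho,
      C0_in (@in_H2 R G) (@norm_H2 R G) T m &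
      forall t, 0 < t <= T ->
        flow_equations a b c gamma (rho t) (m t) (drho t) (dm t)].

Definition energy (R : realType) (G : network R) (c : edge G -> R) (gamma : R)
    (rho m : netfun G) : R :=
  net_integral (fun e x =>
    m e x ^+ 2 / (2 * rho e x) + potential c gamma e (rho e x)).

Definition dissipation (R : realType) (G : network R) (a b : edge G -> R)
    (rho m : netfun G) : R :=
  net_integral (fun e x =>
    a e * (`|dx m e x| ^+ 2 / `|rho e x| ^+ 2) +
    b e * (`|m e x| ^+ 3 / `|rho e x| ^+ 2)).

(* Main.v *)
(* The energy balance is the identity
     d/dt (m^2/(2 rho) + P(rho)) = - d/dx (m (h - a w)) - a |m'|^2/rho^2 - b |m|^3/rho^2
   with h = m^2/(2 rho^2) + P'(rho) and w = m'/rho^2, integrated over the edges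
   and over time: at an inner vertex h - a w does not depend on the edge, so
   that the boundary terms cancel by conservation of mass, and at a boundary
   vertex m vanishes.
   In space, the functions involved have absolutely continuous representatives:
   du Bois-Reymond's lemma, obtained by testing with B-splines that shrink to
   Lebesgue points, identifies a function having an integrable weak derivative
   with a primitive of the latter. The chain rule for such primitives
   then gives the weak derivatives in the momentum equation, and their boundary
   values are the traces.
   In time, the difference quotients of rho converge uniformly and those of m in
   L^1, while rho(s), m(s) and m'(s) converge uniformly to rho(t), m(t), m'(t)
   (for m and m' because H^1 embeds into L^oo). Hence the energy is
   differentiable on ]0, T[, continuous on [0, T], and the dissipation is
   continuous; the fundamental theorem of calculus concludes. *)
Require Import Defs.
From HB Require Import structures.
From mathcomp Require Import all_boot all_order all_algebra.
From mathcomp Require Import all_classical all_reals all_analysis.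
From mathcomp Require Import measurable_realfun ess_sup_inf ring lra.
Set Implicit Arguments.
Unset Strict Implicit.
Unset Printing Implicit Defensive.
Import Order.TTheory GRing.Theory Num.Theory.
Import numFieldNormedType.Exports.
Local Open Scope classical_set_scope.
Local Open Scope ring_scope.

(** * Functions with a locally dominated increment are constant *)

(** The chain rule is needed for functions whose derivative is merely in [L^1], where the mean value
    theorem does not apply. Instead, the increments of a discrepancy [D] are compared with those of
    a nondecreasing [K], a primitive of [|g|]: if they are locally at most [e] times those of [K],
    for every [e], then [D] is constant. The product rule follows by polarisation.

    Weak derivatives and continuous representatives are chosen by [xget], so that [dx] is linear
    only up to null sets. Identities are therefore carried almost everywhere, and become pointwise
    only between continuous functions.

    In space, the multipliers are [m/rho] for the momentum equation and [P'(rho) - m^2/(2 rho^2)]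
    for the mass equation; [rho P'' = p'] turns the pressure gradient into a gradient of [P']. In
    time, the quotients of [m] are controlled in [L^2] only, so the increment of the energy is split
    in such a way that this quotient occurs linearly, against factors that converge uniformly. *)

Lemma locally_le_mono (R : realType) (l : R) (D : R -> R) :
  (forall x, 0 <= x <= l -> exists2 d, 0 < d &
     forall y, 0 <= y <= l -> `|y - x| < d ->
       (x <= y -> D x <= D y) /\ (y <= x -> D y <= D x)) ->
  forall x, 0 <= x <= l -> D 0 <= D x.
Proof.
move=> loc x1 /andP[x10 x1l].
(* Real induction: the bound is carried to the supremum [c] of the points up to which it persists,
   and then past it. *)
pose S := [set x | 0 <= x <= x1 /\ forall z, 0 <= z <= x -> D 0 <= D z].
have S0 : S 0.
  split; first by rewrite lexx.
  by move=> z /andP[z0 z0']; have -> : z = 0 by apply/eqP; rewrite eq_le z0 z0'.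
have Sub x : S x -> x <= x1 by case=> /andP[].
have hS : has_sup S by split; [exists 0 | exists x1 => x /Sub].
set c := sup S.
have c0 : 0 <= c by apply: (ub_le_sup hS.2 S0).
have cx1 : c <= x1 by apply: ge_sup; [exists 0| move=> x /Sub].
have [|d d0 hd] := loc c; first by rewrite c0 (le_trans cx1).
have Sc : D 0 <= D c.
  have [x Sx xc] : exists2 x, S x & c - d < x.
    by apply: sup_adherent => //.
  have xlec : x <= c by apply: (ub_le_sup hS.2 Sx).
  have [/andP[x0 xx1] hx] := Sx.
  have [||_ /(_ xlec) h] := hd x.
  - by rewrite x0 (le_trans xx1).
  - by rewrite distrC ger0_norm ?subr_ge0// ltrBlDr addrC -ltrBlDr.
  - by apply: le_trans h; apply: hx; rewrite x0 lexx.
have Slt z : 0 <= z -> z < c -> D 0 <= D z.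
  move=> z0 zc.
  have [x Sx xc] : exists2 x, S x & c - (c - z) < x.
    by apply: sup_adherent => //; rewrite subr_gt0.
  have [_ hx] := Sx; apply: hx; rewrite z0 ltW//.
  by move: xc; rewrite opprB addrC subrK.
have [->//|cnx] := eqVneq x1 c.
have {cnx}cx1' : c < x1 by rewrite lt_neqAle eq_sym cnx.
(* The half keeps every point between [c] and [c'] strictly within [d] of [c]. *)
pose c' := Num.min x1 (c + d / 2).
have cc' : c < c' by rewrite /c' lt_min cx1' ltrDl divr_gt0.
suff : S c' by move=> /(ub_le_sup hS.2); rewrite leNgt cc'.
split; first by rewrite (le_trans c0 (ltW cc'))/= /c' ge_min lexx.
move=> z /andP[z0 zc'].
have [zc|cz] := ltP z c; first exact: Slt.
move: zc'; rewrite /c' le_min => /andP[zx1 zcd].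
have [||/(_ cz) h _] := hd z.
- by rewrite z0 (le_trans zx1).
- rewrite ger0_norm ?subr_ge0// ltrBlDl (le_lt_trans zcd)// ltrD2l.
  by rewrite ltr_pdivrMr// mulr_natr mulr2n ltrDl.
- exact: le_trans h.
Qed.

(** Both [D + e * K] and [- D + e * K] are locally nondecreasing, hence bounded below by their value
    at 0; so [|D x - D 0| <= e * (K x - K 0)] for every [e]. With [K] the identity this is the
    classical theorem on zero derivatives; a general [K] admits derivatives that are only
    integrable. *)
Lemma locally_dominated_cst (R : realType) (l : R) (D K : R -> R) :
  (forall x y, 0 <= x -> x <= y -> y <= l -> K x <= K y) ->
  (forall x e, 0 <= x <= l -> 0 < e -> exists2 d, 0 < d &
     forall y, 0 <= y <= l -> `|y - x| < d ->
       `|D y - D x| <= e * `|K y - K x|) ->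
  forall x, 0 <= x <= l -> D x = D 0.
Proof.
move=> Km loc x xl.
have key e : 0 < e -> `|D x - D 0| <= e * (K x - K 0).
  move=> e0.
  have half (s : R) : `|s| = 1 -> s * D 0 + e * K 0 <= s * D x + e * K x.
    move=> s1.
    apply: (@locally_le_mono _ l (fun x => s * D x + e * K x)) xl => z zl.
    have [d d0 hd] := loc z e zl e0; exists d => // y yl yz.
    have := hd y yl yz.
    rewrite -[`|D y - D z|]mul1r -s1 -normrM => h; split=> zy.
      have K0 : 0 <= K y - K z by rewrite subr_ge0; apply: Km => //; [case/andP: zl|case/andP: yl].
      rewrite (ger0_norm K0) in h.
      by move: h; rewrite ler_norml => /andP[]; lra.
    have K0 : K y - K z <= 0 by rewrite subr_le0; apply: Km => //; [case/andP: yl|case/andP: zl].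
    rewrite (ler0_norm K0) in h.
    by move: h; rewrite ler_norml => /andP[]; lra.
  have h1 := half 1 (normr1 _).
  have h2 := half (-1) (normrN1 _).
  by rewrite ler_norml; apply/andP; split; lra.
apply/eqP; rewrite -subr_eq0 -normr_le0.
have K0 : 0 <= K x - K 0 by rewrite subr_ge0; apply: Km => //; case/andP: xl.
apply/ler_addgt0Pl => e e0; rewrite addr0.
(* The added 1 permits the division even when [K x = K 0]. *)
have c0 : 0 < K x - K 0 + 1 by rewrite ltr_wpDl.
apply: le_trans (key (e / (K x - K 0 + 1)) _) _; first exact: divr_gt0.
by rewrite mulrAC ler_pdivrMr// ler_pM2l// lerDl.
Qed.

(** A form without division, valid at [y = z] too, which suits the comparison of increments. *)
Lemma is_derive1P (R : realType) (f : R -> R) (z df : R) :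
  is_derive z 1 f df <->
  forall e, 0 < e -> exists2 d, 0 < d & forall y, `|y - z| < d ->
    `|f y - f z - df * (y - z)| <= e * `|y - z|.
Proof.
have quotE (h : R) : h != 0 ->
    `|f (h + z) - f z - df * h| = `|df - h^-1 * (f (h + z) - f z)| * `|h|.
  move=> h0; rewrite -normrM mulrBl mulrAC mulVf// mul1r -normrN.
  by congr `| _ |; lra.
split.
- move=> [dv vE] e e0.
  move: dv; rewrite /derivable => /cvg_ex[L hL].
  have LE : L = df by rewrite -vE; apply/esym/cvg_lim.
  rewrite {}LE in hL.
  move/cvgrPdist_le : hL => /(_ e e0); rewrite near_withinE.
  move=> /nbhs_ballP[d /= d0 hd]; exists d => // y yd.
  have [->|yz] := eqVneq y z; first by rewrite !subrr mulr0 subrr normr0 mulr0.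
  have h0 : y - z != 0 by rewrite subr_eq0.
  have := hd (y - z); rewrite /ball/= sub0r normrN => /(_ yd h0).
  rewrite /GRing.scale/= mulr1 => h.
  have := quotE _ h0; rewrite subrK => ->.
  by rewrite ler_wpM2r// -[X in _ - _ * (f X - _)](subrK z).
- move=> hf.
  have hL : h^-1 *: ((f \o shift z) (h *: (1 : R)) - f z) @[h --> 0^'] --> df.
    apply/cvgrPdist_le => e e0; have [d d0 hd] := hf e e0.
    rewrite near_withinE; apply/nbhs_ballP; exists d => //= h.
    rewrite /ball/= sub0r normrN => hd' h0.
    have := hd (h + z); rewrite addrK => /(_ hd').
    by rewrite /GRing.scale/= mulr1 quotE// ler_pM2r// normr_gt0.
  by split; [apply/cvg_ex; exists df | apply/cvg_lim].
Qed.

(** * Calculus of absolutely continuous functions *)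

Section ac_calculus.
Context {R : realType}.
Notation mu := (@lebesgue_measure R).
Implicit Types (l : R) (f g h U V : R -> R).

Definition integ l f := mu.-integrable `[0, l] (EFin \o f).

Definition prim f (x : R) := \int[mu]_(s in `[0, x]) f s.

(* [U] is absolutely continuous on [0, l], with derivative [g] in L^1(0, l). *)
Definition acd l U g :=
  integ l g /\ forall x, 0 <= x <= l -> U x = U 0 + prim g x.

Lemma within_itvP l f :
  {within `[0, l], continuous f} <->
  (forall x e, 0 <= x <= l -> 0 < e -> exists2 d, 0 < d &
    forall y, 0 <= y <= l -> `|y - x| < d -> `|f y - f x| < e).
Proof.
rewrite subspace_continuousP; split.
- move=> cf x e xl e0.
  have /= := cf x; rewrite in_itv/= => /(_ xl).
  move=> /cvgrPdist_lt /(_ e e0); rewrite near_withinE => /nbhs_ballP[d /= d0 hd].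
  exists d => // y yl yx; rewrite distrC.
  by apply: hd; rewrite /= ?in_itv/= // /ball/= distrC.
- move=> h x /=; rewrite in_itv/= => xl.
  apply/cvgrPdist_lt => e e0; rewrite near_withinE; apply/nbhs_ballP.
  have [d d0 hd] := h x e xl e0; exists d => //= y yx; rewrite /= in_itv/= => yl.
  by rewrite distrC; apply: hd => //; rewrite distrC.
Qed.

Lemma integD l f g : integ l f -> integ l g -> integ l (fun x => f x + g x).
Proof. by move=> lf lg; apply: (integrableD _ lf lg). Qed.

Lemma integZ l k f : integ l f -> integ l (fun x => k * f x).
Proof. by move=> lf; apply: (integrableZl _ k lf). Qed.

Lemma integN l f : integ l f -> integ l (fun x => - f x).
Proof. by move=> lf; exact: (integrableN lf). Qed.

Lemma integB l f g : integ l f -> integ l g -> integ l (fun x => f x - g x).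
Proof. by move=> lf /integN; exact: integD. Qed.

Lemma integ_norm l f : integ l f -> integ l (fun x => `|f x|).
Proof. exact: integrable_norm. Qed.

Lemma integ_cst l (k : R) : integ l (cst k).
Proof.
apply: continuous_compact_integrable; first exact: segment_compact.
by apply: continuous_subspaceT => x; exact: cvg_cst.
Qed.

Lemma eq_integ l f g : (forall x, 0 <= x <= l -> f x = g x) -> integ l f -> integ l g.
Proof.
move=> fg; apply: eq_integrable => // x; rewrite inE/= in_itv/= => xl.
by rewrite fg.
Qed.

Lemma within_bounded l f : {within `[0, l], continuous f} ->
  exists2 M, 0 < M & forall x, 0 <= x <= l -> `|f x| <= M.
Proof.
move=> cf.
have /compact_bounded[M [_ hM]] := continuous_compact cf (@segment_compact R 0 l).
exists (`|M| + 1); first by rewrite ltr_wpDl.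
move=> x xl; apply: (hM (`|M| + 1)); first by rewrite (le_lt_trans (ler_norm M))// ltrDl.
by exists x => //; rewrite /= in_itv.
Qed.

Lemma within_measurable l f : {within `[0, l], continuous f} ->
  measurable_fun `[0, l] f.
Proof. by move=> cf; apply: subspace_continuous_measurable_fun. Qed.

Lemma integM_bounded l f g M : measurable_fun `[0, l] f ->
  (forall x, 0 <= x <= l -> `|f x| <= M) -> integ l g ->
  integ l (fun x => f x * g x).
Proof.
move=> mf fM ig.
apply: (@integrableMr _ _ _ mu `[0, l] _ f (EFin \o g) mf _ ig) => //.
exists M; split; first by rewrite num_real.
by move=> N MN x /=; rewrite in_itv/= => xl; rewrite (le_trans (fM x xl))// ltW.
Qed.

Lemma integ_contM l f g : {within `[0, l], continuous f} -> integ l g ->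
  integ l (fun x => f x * g x).
Proof.
move=> cf ig; have [M _ fM] := within_bounded cf.
by apply: integM_bounded fM ig; exact: within_measurable.
Qed.

Lemma integS l x y f : 0 <= x -> y <= l -> integ l f -> mu.-integrable `]x, y] (EFin \o f).
Proof.
move=> x0 yl; apply: integrableS => //=.
by move=> z /=; rewrite !in_itv/= => /andP[? ?]; apply/andP; split; lra.
Qed.

Lemma prim_sub l f x y : integ l f -> 0 <= x -> x <= y -> y <= l ->
  prim f y - prim f x = \int[mu]_(s in `]x, y]) f s.
Proof.
move=> lf x0 xy yl; rewrite /prim Rintegral_itvB//.
by apply: integrableS lf => //= z /=; rewrite !in_itv/= => /andP[? ?]; apply/andP; split; lra.
Qed.

Lemma prim0 f : prim f 0 = 0.
Proof. by rewrite /prim set_itv1 Rintegral_set1. Qed.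

Lemma acd_within l U g : acd l U g -> {within `[0, l], continuous U}.
Proof.
move=> [ig Ug].
have [l0|l0] := ltP l 0.
  by rewrite set_itv_ge ?bnd_simp -?ltNge//; exact: continuous_subspace0.
have /within_itvP cP := parameterized_integral_continuous l0 ig.
apply/within_itvP => x e xl e0; have [d d0 hd] := cP x e xl e0.
exists d => // y yl yx; rewrite Ug// (Ug x)// opprD addrACA subrr add0r.
exact: hd.
Qed.

Lemma norm_int_le l x y f g : integ l f -> integ l g ->
  0 <= x -> y <= l -> (forall s, x < s <= y -> `|f s| <= g s) ->
  `| \int[mu]_(s in `]x, y]) f s | <= \int[mu]_(s in `]x, y]) g s.
Proof.
move=> lf lg x0 yl fg.
have if' := integS x0 yl lf; have ig' := integS x0 yl lg.
apply: (le_trans (le_normr_Rintegral _ if')) => //.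
by apply: le_Rintegral => //; exact: integrable_norm.
Qed.

(* Primitives of [A * g] behave to first order like [A x] times those of [g]. *)
Lemma prim_osc l (A g : R -> R) : {within `[0, l], continuous A} -> integ l g ->
  forall x e, 0 <= x <= l -> 0 < e -> exists2 d, 0 < d &
    forall y, 0 <= y <= l -> `|y - x| < d ->
    `|(prim (fun s => A s * g s) y - prim (fun s => A s * g s) x) -
       A x * (prim g y - prim g x)| <=
    e * `|prim (fun s => `|g s|) y - prim (fun s => `|g s|) x|.
Proof.
move=> cA ig x e xl e0.
have iAg := integ_contM cA ig.
have /within_itvP/(_ x e xl e0)[d d0 hd] := cA.
exists d => // y yl yx.
have key u v : 0 <= u -> u <= v -> v <= l -> (forall s, u < s <= v -> `|A s - A x| <= e) ->
   `|(prim (fun s => A s * g s) v - prim (fun s => A s * g s) u) -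
       A x * (prim g v - prim g u)| <=
    e * `|prim (fun s => `|g s|) v - prim (fun s => `|g s|) u|.
  move=> u0 uv vl hA.
  have ign := integ_norm ig.
  rewrite (prim_sub iAg)// (prim_sub ig)// (prim_sub ign)//.
  rewrite -RintegralZl//; last exact: integS ig.
  rewrite -RintegralB//; last 2 first.
  - exact: integS iAg.
  - by have := integZ (A x) ig; apply: integS.
  have -> : `|\int[mu]_(s in `]u, v]) `|g s| | = \int[mu]_(s in `]u, v]) `|g s|.
    by rewrite ger0_norm// Rintegral_ge0.
  rewrite -RintegralZl//; last exact: integS ign.
  apply: (@norm_int_le l) => //.
  - by apply: integB => //; exact: integZ.
  - exact: integZ.
  - by move=> s /hA hs; rewrite -mulrBl normrM ler_wpM2r.
move: xl yl => /andP[x0 xl] /andP[y0 yl].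
have [xy|/ltW yx'] := leP x y.
  apply: key => // s /andP[xs sy]; apply/ltW/hd.
    by apply/andP; split; lra.
  by move: yx; rewrite !ger0_norm; lra.
rewrite -opprB -[prim g y - _]opprB mulrN -opprD normrN -[prim (fun s => `|g s|) y - _]opprB normrN.
apply: key => // s /andP[xs sy]; apply/ltW/hd.
  by apply/andP; split; lra.
by move: yx; rewrite distrC [`|s - x|]distrC !ger0_norm; lra.
Qed.

Lemma prim_le l f x y : integ l f -> (forall s, 0 <= f s) ->
  0 <= x -> x <= y -> y <= l -> prim f x <= prim f y.
Proof.
move=> lf f0 x0 xy yl; rewrite -subr_ge0 (prim_sub lf)//.
by apply: Rintegral_ge0.
Qed.

(** The increments of [F \o U] minus the candidate primitive carry two errors: the first-order
    remainder of [F] at [U x], and the oscillation of [F' \o U] near [x], handled by [prim_osc].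
    Each is at most [e / 2] times the increment of the primitive of [|g|]. *)
Lemma acd_comp l U g (F F' : R -> R) : acd l U g ->
  (forall x, 0 <= x <= l -> is_derive (U x) 1 F (F' (U x))) ->
  {within `[0, l], continuous (F' \o U)} ->
  acd l (F \o U) (fun x => F' (U x) * g x).
Proof.
move=> acU dF cF'.
have cU := acd_within acU; have [ig Ug] := acU.
have ih := integ_contM cF' ig.
split=> // x xl /=.
have ign := integ_norm ig.
pose D x := F (U x) - prim (fun x => F' (U x) * g x) x.
suff : D x = D 0 by rewrite /D prim0; lra.
move: x xl; apply: (@locally_dominated_cst _ l D (prim (fun s => `|g s|))).
  by move=> x y x0 xy yl; exact: (prim_le ign).
move=> x e xl e0.
have e20 : 0 < e / 2 by rewrite divr_gt0.
have [d1 d10 hd1] := prim_osc cF' ig xl e20.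
have [d2 d20 hd2] : exists2 d, 0 < d & forall y, `|y - U x| < d ->
    `|F y - F (U x) - F' (U x) * (y - U x)| <= e / 2 * `|y - U x|.
  by have /is_derive1P := dF x xl; apply.
have /within_itvP/(_ x d2 xl d20)[d3 d30 hd3] := cU.
exists (Num.min d1 d3); first by rewrite lt_min d10.
move=> y yl; rewrite lt_min => /andP[yd1 yd3].
have h1 := hd1 y yl yd1.
have h2 := hd2 (U y) (hd3 y yl yd3).
have UE : U y - U x = prim g y - prim g x by rewrite Ug// (Ug x)//; lra.
have h3 : `|prim g y - prim g x| <= `|prim (fun s => `|g s|) y - prim (fun s => `|g s|) x|.
  have key u v : 0 <= u -> u <= v -> v <= l -> `|prim g v - prim g u| <=
      `|prim (fun s => `|g s|) v - prim (fun s => `|g s|) u|.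
    move=> u0 uv vl; rewrite (prim_sub ig)// (prim_sub ign)//.
    by apply: le_trans (ler_norm _); exact: (norm_int_le ig).
  move: xl yl => /andP[x0 xl] /andP[y0 yl].
  have [xy|/ltW yx] := leP x y; first exact: key.
  by rewrite distrC [leRHS]distrC; exact: key.
rewrite UE in h2; rewrite /D.
set K := `|prim (fun s => `|g s|) y - _| in h1 h3 *.
have -> : F (U y) - prim (fun x0 : R => F' (U x0) * g x0) y -
   (F (U x) - prim (fun x0 : R => F' (U x0) * g x0) x) =
  (F (U y) - F (U x) - F' (U x) * (prim g y - prim g x)) -
  (prim (fun s : R => (F' \o U) s * g s) y -
          prim (fun s : R => (F' \o U) s * g s) x -
          (F' \o U) x * (prim g y - prim g x)) by rewrite /=; lra.
apply: (le_trans (ler_normB _ _)).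
rewrite [e]splitr mulrDl; apply: lerD => //.
by apply: (le_trans h2); rewrite ler_wpM2l// ltW.
Qed.

Lemma prim_lin l f g a b x : integ l f -> integ l g -> 0 <= x <= l ->
  prim (fun s => a * f s + b * g s) x = a * prim f x + b * prim g x.
Proof.
move=> lf lg /andP[x0 xl].
have sub f' : integ l f' -> mu.-integrable `[0, x] (EFin \o f').
  by apply: integrableS => //= z /=; rewrite !in_itv/= => /andP[? ?]; apply/andP; split; lra.
rewrite /prim RintegralD//; last 2 first.
- by apply: sub; exact: integZ.
- by apply: sub; exact: integZ.
by rewrite !RintegralZl//; exact: sub.
Qed.

Lemma acd_lin l U V g h a b : acd l U g -> acd l V h ->
  acd l (fun x => a * U x + b * V x) (fun x => a * g x + b * h x).
Proof.
move=> [ig Ug] [ih Vh]; split; first by apply: integD; exact: integZ.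
by move=> x xl; rewrite (prim_lin a b ig ih)// Ug// Vh//; lra.
Qed.

Lemma eq_acd l U V g h : (forall x, 0 <= x <= l -> U x = V x) ->
  (forall x, 0 <= x <= l -> g x = h x) -> acd l U g -> acd l V h.
Proof.
move=> UV gh [ig Ug]; split; first exact: eq_integ ig.
move=> x xl; rewrite -UV// Ug//.
have /andP[x0 xl'] := xl.
have <- : U 0 = V 0 by apply: UV; rewrite lexx (le_trans x0).
congr (_ + _); apply: eq_Rintegral => y; rewrite inE/= in_itv/= => /andP[y0 yx].
by apply: gh; rewrite y0 (le_trans yx).
Qed.

Lemma acd_sqr l U g : acd l U g -> acd l (fun x => U x ^+ 2) (fun x => 2 * U x * g x).
Proof.
move=> acU.
apply: (@acd_comp l U g (fun y => y ^+ 2) (fun y => 2 * y)) => //.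
- move=> x _; have -> : (fun y : R => y ^+ 2) = (@id R) * (@id R).
    by apply/funext => y; rewrite expr2.
  by apply: is_derive_eq; rewrite /GRing.scale/= mulr1 mulr_natl mulr2n.
- have := acd_within acU.
  move/within_itvP => h; apply/within_itvP => x e xl e0.
  have [d d0 hd] := h x (e / 2) xl (divr_gt0 e0 (ltr0n _ 2)).
  exists d => // y yl yx; rewrite /= -mulrBr normrM ger0_norm// -ltr_pdivlMl//.
  by rewrite mulrC hd.
Qed.

(** Polarisation, [U V = ((U + V)^2 - (U^2 + V^2)) / 2], reduces the product to squares. *)
Lemma acdM l U V g h : acd l U g -> acd l V h ->
  acd l (fun x => U x * V x) (fun x => g x * V x + U x * h x).
Proof.
move=> acU acV.
have s1 := acd_sqr (acd_lin 1 1 acU acV).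
have s2 := acd_lin 1 1 (acd_sqr acU) (acd_sqr acV).
apply: eq_acd (acd_lin (1/2) (- (1/2)) s1 s2) => x _ /=; first lra.
by lra.
Qed.

Lemma acd_FTC l U g : 0 <= l -> acd l U g -> \int[mu]_(x in `[0, l]) g x = U l - U 0.
Proof.
move=> l0 [ig Ug].
by rewrite (Ug l) ?l0 ?lexx// addrAC subrr add0r.
Qed.

End ac_calculus.

(** * Du Bois-Reymond's lemma *)

Section spline.
Context {R : realType}.
Notation mu := (@lebesgue_measure R).

(** The truncated power. For [n = 0] it is 1 everywhere and not the Heaviside function, because
    [0 ^+ 0 = 1]; hence the successor indices below. *)
Definition ramp (n : nat) (z : R) : R := Num.max 0 z ^+ n.

Lemma ramp_ge0 n z : 0 <= z -> ramp n z = z ^+ n.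
Proof. by move=> z0; rewrite /ramp max_r. Qed.

Lemma ramp_le0 n z : z <= 0 -> ramp n.+1 z = 0.
Proof. by move=> z0; rewrite /ramp max_l// expr0n. Qed.

Lemma is_derive_ramp n (z : R) : is_derive z 1 (ramp n.+2) (n.+2%:R * ramp n.+1 z).
Proof.
have [z0|z0|->] := ltrgtP z 0.
- rewrite ramp_le0 ?ltW// mulr0.
  apply: (@near_eq_is_derive _ _ _ (cst 0)).
  near=> y; have y0 : y < 0 by near: y; exact: lt_nbhsl.
  by rewrite ramp_le0// ltW.
- rewrite ramp_ge0 ?ltW//.
  apply: (@near_eq_is_derive _ _ _ ((@id R) ^+ n.+2)); last first.
    by apply: is_derive_eq; rewrite /GRing.scale/= mulr1.
  near=> y; have y0 : 0 < y by near: y; exact: lt_nbhsr.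
  by rewrite ramp_ge0 ?fctE// ltW.
- rewrite ramp_le0// mulr0.
  (* At 0 the two one-sided formulas are glued: the exponent is at least 2, so the power is at most
     [e * y] for [0 < y < min 1 e]. *)
  apply/is_derive1P => e e0; exists (Num.min 1 e); first by rewrite lt_min ltr01.
  move=> y; rewrite mul0r (@ramp_le0 _ 0)// !subr0 lt_min => /andP[y1 ye].
  have [y0|y0] := leP y 0; first by rewrite ramp_le0// normr0 mulr_ge0// ltW.
  rewrite (ramp_ge0 _ (ltW y0)) normrX exprSr ler_wpM2r//.
  rewrite exprS (le_trans _ (ltW ye))// ler_piMr// exprn_ile1//; exact: ltW.
Unshelve. all: by end_near. Qed.

Lemma is_derive_lin (f g : R -> R) (z a b df dg : R) :
  is_derive z 1 f df -> is_derive z 1 g dg ->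
  is_derive z 1 (fun y => a * f y + b * g y) (a * df + b * dg).
Proof. by move=> hf hg; exact: (is_deriveD (is_deriveZ a hf) (is_deriveZ b hg)). Qed.

(* [spline n] is, up to scaling, the B-spline of degree [n] when [n = 2], and
   its derivative or primitive for [n = 1, 3]. *)
Definition spline n (z : R) : R :=
  1 * (1 * ramp n (z + 3) + -3 * ramp n (z + 1)) +
  1 * (3 * ramp n (z - 1) + -1 * ramp n (z - 3)).

Lemma is_derive_spline n (z : R) :
  is_derive z 1 (spline n.+2) (n.+2%:R * spline n.+1 z).
Proof.
have d (c : R) : is_derive z 1 (fun y => ramp n.+2 (y + c)) (n.+2%:R * ramp n.+1 (z + c)).
  rewrite -[_ * _]mulr1.
  apply: (@is_derive1_comp _ (ramp n.+2) (fun y => y + c)); first exact: is_derive_ramp.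
  rewrite -[X in is_derive _ _ _ X]addr0.
  exact: (is_deriveD (is_derive_id _ _) (is_derive_cst _ _ _)).
have -> : n.+2%:R * spline n.+1 z =
  1 * (1 * (n.+2%:R * ramp n.+1 (z + 3)) + -3 * (n.+2%:R * ramp n.+1 (z + 1))) +
  1 * (3 * (n.+2%:R * ramp n.+1 (z - 1)) + -1 * (n.+2%:R * ramp n.+1 (z - 3))).
  by rewrite /spline; ring.
by apply: is_derive_lin; apply: is_derive_lin; exact: d.
Qed.

Lemma continuous_ramp n : continuous (ramp n).
Proof.
move=> z; apply: (@continuous_comp _ _ _ (fun z : R => Num.max 0 z) (fun z : R => z ^+ n)).
  by apply: (@continuous_max _ _ (cst 0) id); [exact: cst_continuous|exact: cvg_id].
exact: exprn_continuous.
Qed.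

Lemma continuous_spline n : continuous (spline n).
Proof.
have c (a : R) : continuous (fun z => ramp n (z + a)).
  move=> z; apply: (@continuous_comp _ _ _ (fun z : R => z + a) (ramp n)).
    by apply: cvgD; [exact: cvg_id|exact: cvg_cst].
  exact: continuous_ramp.
move=> z; apply: cvgD; apply: cvgM; try exact: cvg_cst.
  by apply: cvgD; apply: cvgM; try exact: cvg_cst; exact: c.
by apply: cvgD; apply: cvgM; try exact: cvg_cst; exact: c.
Qed.

Lemma spline_le n z : z <= -3 -> spline n.+1 z = 0.
Proof. by move=> z3; rewrite /spline !ramp_le0; lra. Qed.

(** To the right of 3 no truncation remains, and [spline] is a third difference with step 2, which
    annihilates quadratic polynomials. *)
Lemma spline2_ge z : 3 <= z -> spline 2 z = 0.
Proof. by move=> z3; rewrite /spline !ramp_ge0; try lra; ring. Qed.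

(** The third difference with step 2 of [z^3] is [3! * 2^3 = 48]. *)
Lemma spline3_ge z : 3 <= z -> spline 3 z = 48.
Proof. by move=> z3; rewrite /spline !ramp_ge0; try lra; ring. Qed.

Lemma spline_bounded : exists2 M, 0 < M & forall z, `|spline 2 z| <= M.
Proof.
have cs : {within `[-3, 3], continuous (spline 2)}.
  by apply: continuous_subspaceT; exact: continuous_spline.
have /compact_bounded[M [_ hM]] := continuous_compact cs (@segment_compact R (-3) 3).
have M0 : 0 < `|M| + 1 by rewrite ltr_wpDl.
exists (`|M| + 1) => // z.
have [z3|z3] := leP z (-3); first by rewrite spline_le// normr0 ltW.
have [z3'|z3'] := leP 3 z; first by rewrite spline2_ge// normr0 ltW.
apply: (hM (`|M| + 1)); first by rewrite (le_lt_trans (ler_norm M))// ltrDl.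
by exists z => //; rewrite /= in_itv/= !ltW.
Qed.

(** Centre [x] and, for [n = 2] and [h > 0], support in [[x - 3 h, x + 3 h]]. Degree 2 is the least
    that gives a [C^1] function; degree 3 supplies primitives. *)
Definition bump n (x h z : R) := spline n ((z - x) / h).

Lemma is_derive_bump n (x h z : R) : h != 0 ->
  is_derive z 1 (bump n.+2 x h) (n.+2%:R / h * bump n.+1 x h z).
Proof.
move=> h0; rewrite mulrAC /bump.
apply: (@is_derive1_comp _ (spline n.+2) (fun z => (z - x) / h) z
  (n.+2%:R * spline n.+1 ((z - x) / h)) h^-1).
  exact: is_derive_spline.
have -> : (fun z => (z - x) / h) = (fun z => h^-1 * z + (- x / h) * 1).
  by apply/funext => y; rewrite mulrBl; ring.
have := @is_derive_lin id (cst 1) z h^-1 (- x / h) 1 0 (is_derive_id _ _) (is_derive_cst _ _ _).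
by rewrite mulr1 mulr0 addr0.
Qed.

Lemma continuous_bump n (x h : R) : continuous (bump n x h).
Proof.
move=> z; apply: (@continuous_comp _ _ _ (fun z : R => (z - x) / h) (spline n)).
  by apply: cvgM; [apply: cvgB; [exact: cvg_id|exact: cvg_cst]|exact: cvg_cst].
exact: continuous_spline.
Qed.

Lemma bump2_out (x h z : R) : 0 < h -> ~ (x - 3 * h < z < x + 3 * h) -> bump 2 x h z = 0.
Proof.
move=> h0 /negP; rewrite negb_and -!leNgt => /orP[] zx.
  by rewrite /bump spline_le// ler_pdivrMr//; lra.
by rewrite /bump spline2_ge// ler_pdivlMr//; lra.
Qed.

Lemma bump3_le x h z : 0 < h -> z <= x - 3 * h -> bump 3 x h z = 0.
Proof. by move=> h0 zx; rewrite /bump spline_le// ler_pdivrMr//; lra. Qed.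

Lemma bump3_ge x h z : 0 < h -> x + 3 * h <= z -> bump 3 x h z = 48.
Proof. by move=> h0 zx; rewrite /bump spline3_ge// ler_pdivlMr//; lra. Qed.

(** The primitive [h / 3 * bump 3 x h] climbs from 0 to [48 * h / 3]. *)
Lemma int_bump2 (x h : R) : 0 < h ->
  \int[mu]_(z in `[x - 3 * h, x + 3 * h]) bump 2 x h z = 16 * h.
Proof.
move=> h0; have d (z : R) : is_derive z 1 (fun z => h / 3 * bump 3 x h z) (bump 2 x h z).
  have <- : h / 3 *: (3 / h * bump 2 x h z) = bump 2 x h z.
    by rewrite /GRing.scale/=; field; rewrite lt0r_neq0.
  exact: (is_deriveZ (h / 3) (is_derive_bump 1 x z (lt0r_neq0 h0))).
rewrite /Rintegral (@continuous_FTC2 _ _ (fun z => h / 3 * bump 3 x h z)).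
- by rewrite -EFinB bump3_ge// bump3_le//=; field.
- lra.
- by apply: continuous_subspaceT; exact: continuous_bump.
- have c (z : R) : {for z, continuous (fun z => h / 3 * bump 3 x h z)}.
    by apply: cvgM; [exact: cvg_cst|exact: continuous_bump].
  split.
  + by move=> z _; exact: (@ex_derive _ _ _ _ _ _ _ (d z)).
  + by apply: cvg_at_right_filter; exact: c.
  + by apply: cvg_at_left_filter; exact: c.
- move=> z _.
  by rewrite derive1E derive_val.
Qed.

End spline.

Section du_bois_reymond.
Context {R : realType}.
Notation mu := (@lebesgue_measure R).
Implicit Types (l : R) (f g u : R -> R).

Lemma ae_imp (P Q : R -> Prop) : (forall x, P x -> Q x) ->
  (\forall x \ae mu, P x) -> \forall x \ae mu, Q x.
Proof. by move=> PQ; apply: (@filterS _ _ (ae_filter_ringOfSetsType mu)). Qed.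

Lemma ae_imp2 (P Q S : R -> Prop) : (forall x, P x -> Q x -> S x) ->
  (\forall x \ae mu, P x) -> (\forall x \ae mu, Q x) -> \forall x \ae mu, S x.
Proof. by move=> PQ; apply: (@filterS2 _ _ (ae_filter_ringOfSetsType mu)). Qed.

Lemma ae_imp3 (P Q S U : R -> Prop) : (forall x, P x -> Q x -> S x -> U x) ->
  (\forall x \ae mu, P x) -> (\forall x \ae mu, Q x) -> (\forall x \ae mu, S x) ->
  \forall x \ae mu, U x.
Proof. by move=> PQ; apply: (@filterS3 _ _ (ae_filter_ringOfSetsType mu)). Qed.

Lemma cvge0_lt (T : Type) (F : set_system T) {FF : Filter F} (f : T -> \bar R) (e : R) :
  f @ F --> 0%E -> 0 < e -> \forall s \near F, (f s < e%:E)%E.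
Proof.
move=> fF e0; apply: (fF [set y | (y < e%:E)%E]).
apply: open_nbhs_nbhs; split; first exact: open_ereal_lt_ereal.
by rewrite /= lte_fin.
Qed.

Lemma locally_integrable_itv (l a b : R) f : locally_integrable `]0, l[ f ->
  0 < a -> b < l -> mu.-integrable `[a, b] (EFin \o f).
Proof.
move=> [mf oD foo] a0 bl.
have sub : `[a, b] `<=` `]0, l[.
  by move=> z /=; rewrite !in_itv/= => /andP[? ?]; apply/andP; split; lra.
apply/integrableP; split; last first.
  by apply: foo => //; exact: segment_compact.
by apply/measurable_EFinP; apply: measurable_funS mf.
Qed.

(** Since the bump has integral [16 * h], the difference is the integral of [(f - f x)] times the
    bump, at most [M] times the integral of [|f - f x|] over a ball of radius [3 * h]. At a Lebesgue
    point this is small compared with [h]. *)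
Lemma int_bump (l : R) f x e : locally_integrable `]0, l[ f ->
  lebesgue_pt f x -> 0 < x < l -> 0 < e ->
  exists2 d, 0 < d & forall h, 0 < h < d ->
    [/\ 0 < x - 3 * h, x + 3 * h < l &
    `|\int[mu]_(z in `]0, l[) (f z * bump 2 x h z) - 16 * h * f x| <= e * h].
Proof.
move=> lf lx /andP[x0 xl] e0.
have [M M0 hM] := @spline_bounded R.
(* The ball has length [6 * h] and [M] bounds the bump, so that a mean oscillation of [e / (6 * M)]
   contributes [e * h]. *)
have e1 : 0 < e / (6 * M) by rewrite divr_gt0// mulr_gt0.
have [d1 d10 hd1] : exists2 d, 0 < d & forall r, 0 < r < d ->
    (davg f x r <= (e / (6 * M))%:E)%E.
  have : \forall r \near (0 : R)^'+, (davg f x r < (e / (6 * M))%:E)%E.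
    exact: (cvge0_lt lx e1).
  rewrite near_withinE => /nbhs_ballP[d /= d0 hd].
  exists d => // r /andP[r0 rd]; apply/ltW/hd => //.
  by rewrite /ball/= sub0r normrN gtr0_norm.
exists (Num.min (d1 / 3) (Num.min (x / 3) ((l - x) / 3))).
  by rewrite !lt_min !divr_gt0 ?subr_gt0.
move=> h /andP[h0]; rewrite !lt_min => /and3P[hd hx hl].
have a0 : 0 < x - 3 * h by move: hx; rewrite ltr_pdivlMr//; lra.
have bl : x + 3 * h < l by move: hl; rewrite ltr_pdivlMr//; lra.
split => //.
set B := [set` `]x - 3 * h, x + 3 * h[].
have mB : measurable B by exact: measurable_itv.
have iB : mu.-integrable B (EFin \o f).
  apply: integrableS (locally_integrable_itv lf a0 bl) => //.
  by move=> z; rewrite /B/= !in_itv/= => /andP[? ?]; apply/andP; split; lra.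
have bb z : `|bump 2 x h z| <= M by exact: hM.
have mb : measurable_fun setT (bump 2 x h).
  by apply: continuous_measurable_fun; exact: continuous_bump.
have iMB g : mu.-integrable B (EFin \o g) ->
    mu.-integrable B (EFin \o (fun z => g z * bump 2 x h z)).
  move=> ig; apply: (@integrableMl _ _ _ mu B _ (EFin \o g) (bump 2 x h) ig) => //.
    by apply: measurable_funTS.
  by exists M; split; [rewrite num_real|move=> N MN z _; rewrite /= (le_trans (bb z))// ltW].
have -> : \int[mu]_(z in `]0, l[) (f z * bump 2 x h z) = \int[mu]_(z in B) (f z * bump 2 x h z).
  have <- : `]0, l[ `&` B = B.
    apply/setIidPr => z; rewrite /B/= !in_itv/= => /andP[? ?].
    by apply/andP; split; lra.
  rewrite Rintegral_mkcondr; apply: eq_Rintegral => z _; rewrite patchE.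
  case: ifPn => // /negP zB; rewrite bump2_out ?mulr0// => hz.
  by apply: zB; rewrite inE /B/= in_itv.
have icst (k : R) : mu.-integrable B (EFin \o cst k).
  have := @integ_cst R l k; apply: integrableS => //.
  by move=> z; rewrite /B/= !in_itv/= => /andP[? ?]; apply/andP; split; lra.
have <- : \int[mu]_(z in B) (f x * bump 2 x h z) = 16 * h * f x.
  have i1 := iMB _ (icst 1).
  have i1' : mu.-integrable B (EFin \o bump 2 x h).
    by apply: eq_integrable i1 => // z _ /=; rewrite mul1r.
  rewrite RintegralZl// mulrC; congr (_ * _).
  rewrite -(int_bump2 x h0); congr fine; apply/esym; apply: integral_itv_bndoo => //.
  by apply/measurable_EFinP; exact: measurable_funTS.
rewrite -RintegralB//; last 2 first.
- exact: iMB.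
- exact: iMB (icst (f x)).
have ifx : mu.-integrable B (EFin \o (fun z => f z - f x)).
  exact: (integrableB _ iB (icst (f x))).
have h3 : 0 < 3 * h < d1 by apply/andP; split; [lra|move: hd; rewrite ltr_pdivlMr//; lra].
have := hd1 (3 * h) h3.
rewrite /davg /iavg lebesgue_measure_ball; last lra.
rewrite ball_itv -/B.
have -> : (\int[mu]_(y in B) `|((center (f x) \o f) y)%:E|)%E = (\int[mu]_(z in B) `|f z - f x|)%:E.
  rewrite /Rintegral fineK//.
  by apply: integrable_fin_num => //; exact: integrable_norm.
rewrite inver ifF; last by rewrite mulrn_eq0/=; apply/negbTE; lra.
rewrite -EFinM lee_fin => hI.
have : `|\int[mu]_(z in B) (f z * bump 2 x h z - f x * bump 2 x h z)| <=
   M * \int[mu]_(z in B) `|f z - f x|.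
  have iB' := iMB _ ifx.
  rewrite -RintegralZl//; last exact: integrable_norm.
  under eq_Rintegral do rewrite -mulrBl.
  apply: (le_trans (le_normr_Rintegral _ iB')) => //.
  apply: le_Rintegral => //.
  - exact: integrable_norm iB'.
  - by have := integrableZl _ M (integrable_norm ifx); apply.
  - by move=> z _; rewrite normrM mulrC ler_wpM2r.
move=> /le_trans; apply.
rewrite -ler_pdivlMl//.
move: hI.
rewrite ler_pdivrMl; last by rewrite mulr2n; lra.
move=> /le_trans; apply; rewrite le_eqVlt; apply/orP; left; apply/eqP.
by rewrite mulr2n; field; rewrite lt0r_neq0.
Qed.

(** [f] need not be integrable up to the end points: the differentiation theorem is applied to its
    restrictions to [[1/(n+1), l - 1/(n+1)]], and countably many null sets are united. *)
Lemma ae_lebesgue_pt l f : locally_integrable `]0, l[ f ->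
  \forall x \ae mu, 0 < x < l -> lebesgue_pt f x.
Proof.
move=> lf.
have key n : \forall x \ae mu, n.+1%:R^-1 < x < l - n.+1%:R^-1 -> lebesgue_pt f x.
  set a : R := n.+1%:R^-1; set b := l - a.
  have a0 : 0 < a by rewrite invr_gt0.
  have iab : mu.-integrable `[a, b] (EFin \o f).
    by apply: locally_integrable_itv lf _ _; rewrite /b; lra.
  have := lebesgue_differentiation (integrable_locally_restrict (measurable_itv _) iab).
  apply: ae_imp => x lx /andP[ax xb].
  (* Around an interior point, [f] and its restriction have the same averages at small radii. *)
  rewrite /lebesgue_pt; apply: cvg_trans lx; apply: near_eq_cvg.
  have ax' : (BLeft a < BRight x)%E by rewrite lte_fin.
  by move: (near_davg f xb ax'); apply: filterS => r /esym.
have : \forall x \ae mu, forall n, n.+1%:R^-1 < x < l - n.+1%:R^-1 -> lebesgue_pt f x.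
  exact: ae_foralln key.
apply: ae_imp => x hx /andP[x0 xl].
have [n hn] : exists n, n.+1%:R^-1 < Num.min x (l - x).
  have m0 : 0 < Num.min x (l - x) by rewrite lt_min x0 subr_gt0.
  near \oo => n; exists n; near: n.
  exact: near_infty_natSinv_lt (PosNum m0).
apply: (hx n); move: hn; rewrite lt_min; move: n.+1%:R^-1 => r /andP[? ?]; apply/andP; split; lra.
Unshelve. all: by end_near. Qed.

Lemma test_functionP l (a b : R) (phi : R -> R) : 0 < a -> b < l ->
  (forall x, derivable phi x 1) -> continuous (derive1 phi) ->
  (forall x, ~ (a <= x <= b) -> phi x = 0) -> test_function l phi.
Proof.
move=> a0 bl dphi cphi out; split => //.
apply: (@subset_trans _ `[a, b]).
  have /closure_id -> : closed `[a, b] by exact: itv_closed.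
  apply: closureS => x /= px; rewrite in_itv/=; apply: contrapT => /out px0.
  by rewrite px0 eqxx in px.
by move=> x /=; rewrite !in_itv/= => /andP[? ?]; apply/andP; split; lra.
Qed.

(** Testing with the bump of scale [h] at a Lebesgue point gives [16 * h * |f x| <= e * h]. *)
Lemma du_bois_reymond0 l f : locally_integrable `]0, l[ f ->
  (forall phi, test_function l phi -> \int[mu]_(x in `]0, l[) (f x * phi x) = 0) ->
  \forall x \ae mu, 0 < x < l -> f x = 0.
Proof.
move=> lf h0; apply: ae_imp (ae_lebesgue_pt lf) => x lx xl.
have {}lx := lx xl.
apply/eqP; rewrite -normr_le0; apply/ler_addgt0Pl => e e0; rewrite addr0.
have [d d0 hd] := int_bump lf lx xl e0.
have hd2 : 0 < d / 2 < d by apply/andP; split; lra.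
have [a0 bl] := hd (d / 2) hd2.
have d2 : 0 < d / 2 by lra.
rewrite h0; last first.
  apply: (@test_functionP _ _ _ _ a0 bl).
  - move=> z; have := is_derive_bump 0 x z (lt0r_neq0 d2).
    exact: (@ex_derive _ _ _ _ _ _ _).
  - have -> : derive1 (bump 2 x (d / 2)) = (fun z => 2 / (d / 2) * bump 1 x (d / 2) z).
      apply/funext => z; rewrite derive1E.
      by have [_ ->] := is_derive_bump 0 x z (lt0r_neq0 d2).
    by move=> z; apply: cvgM; [exact: cvg_cst|exact: continuous_bump].
  - move=> z hz; rewrite bump2_out// => /andP[? ?]; apply: hz.
    by apply/andP; split; lra.
have d8 : 0 <= 16 * (d / 2) by lra.
rewrite sub0r normrN normrM (ger0_norm d8) => h.
rewrite -(ler_pM2r d2); have := normr_ge0 (f x); nra.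
Qed.

Lemma integrable_bump l f (x h : R) : locally_integrable `]0, l[ f -> 0 < h ->
  0 < x - 3 * h -> x + 3 * h < l ->
  mu.-integrable `]0, l[ (EFin \o (fun z => f z * bump 2 x h z)).
Proof.
move=> lf h0 a0 bl.
set B := [set` `[x - 3 * h, x + 3 * h]].
have mB : measurable B by exact: measurable_itv.
have [M M0 hM] := @spline_bounded R.
have iB : mu.-integrable B (EFin \o (fun z => f z * bump 2 x h z)).
  have ig := locally_integrable_itv lf a0 bl.
  apply: (@integrableMl _ _ _ mu B _ (EFin \o f) (bump 2 x h) ig) => //.
    by apply: measurable_funTS; apply: continuous_measurable_fun; exact: continuous_bump.
  by exists M; split; [rewrite num_real|move=> N MN z _; rewrite /= (le_trans (hM _))// ltW].
have -> : EFin \o (fun z => f z * bump 2 x h z) = (EFin \o (fun z => f z * bump 2 x h z)) \_ B.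
  apply/funext => z; rewrite /= patchE; case: ifPn => // /negP zB.
  rewrite bump2_out ?mulr0// => /andP[z1 z2].
  by apply: zB; rewrite inE /B/= in_itv/= !ltW.
apply/(integrable_restrict mu mB) => //.
by apply: integrableS iB => //; exact: measurableI.
Qed.

(** Two Lebesgue points are compared directly, through a test function whose derivative is the
    difference of two bumps of the same scale; no correction of a general test function by one of
    mean 1 is required. *)
Lemma du_bois_reymond1 l f : locally_integrable `]0, l[ f ->
  (forall phi, test_function l phi -> \int[mu]_(x in `]0, l[) (f x * derive1 phi x) = 0) ->
  exists c, \forall x \ae mu, 0 < x < l -> f x = c.
Proof.
move=> lf h0.
have key x y : 0 < x < l -> 0 < y < l -> lebesgue_pt f x -> lebesgue_pt f y -> f x = f y.
  move=> xl yl lx ly.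
  apply/eqP; rewrite -subr_eq0 -normr_le0; apply/ler_addgt0Pl => e e0; rewrite addr0.
  have [d d0 hd] := int_bump lf lx xl e0.
  have [d' d'0 hd'] := int_bump lf ly yl e0.
  have [h [h_gt0 hltd hltd']] : exists h, [/\ 0 < h, h < d & h < d'].
    exists (Num.min d d' / 2).
    have : 0 < Num.min d d' by rewrite lt_min d0.
    have : Num.min d d' <= d by rewrite ge_min lexx.
    have : Num.min d d' <= d' by rewrite ge_min lexx orbT.
    by split; lra.
  have [a0 bl hx] := hd h (ltac:(by rewrite h_gt0)).
  have [a0' bl' hy] := hd' h (ltac:(by rewrite h_gt0)).
  (* To the right of both bumps the two terms are [16 * h] and [- (16 * h)], so [phi] vanishes
     there; the factor [h / 3] makes [phi'] exactly the difference of the quadratic bumps. *)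
  pose phi z := h / 3 * bump 3 x h z + - (h / 3) * bump 3 y h z.
  have hn0 := lt0r_neq0 h_gt0.
  have dphi (z : R) : is_derive z 1 phi (bump 2 x h z - bump 2 y h z).
    have -> : bump 2 x h z - bump 2 y h z =
      h / 3 * (3 / h * bump 2 x h z) + - (h / 3) * (3 / h * bump 2 y h z) by field.
    by apply: is_derive_lin; exact: is_derive_bump.
  have phi'E : derive1 phi = (fun z => bump 2 x h z - bump 2 y h z).
    by apply/funext => z; rewrite derive1E; have [_ ->] := dphi z.
  have tphi : test_function l phi.
    apply: (@test_functionP _ (Num.min (x - 3 * h) (y - 3 * h)) (Num.max (x + 3 * h) (y + 3 * h))).
    - by rewrite lt_min a0.
    - by rewrite gt_max bl.
    - by move=> z; exact: (@ex_derive _ _ _ _ _ _ _ (dphi z)).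
    - by rewrite phi'E => z; apply: cvgB; exact: continuous_bump.
    - move=> z /negP; rewrite negb_and -!ltNge lt_min gt_max => /orP[]/andP[z1 z2].
        by rewrite /phi !bump3_le ?ltW//; lra.
      by rewrite /phi !bump3_ge ?ltW//; lra.
  have := h0 _ tphi; rewrite phi'E.
  under eq_Rintegral do rewrite mulrBr.
  rewrite RintegralB//; [|exact: integrable_bump|exact: integrable_bump].
  move=> Ixy; rewrite -(ler_pM2r h_gt0).
  move: hx hy; rewrite !ler_norml => /andP[x1 x2] /andP[y1 y2].
  have -> : `|f x - f y| * h = `|(f x - f y) * h| by rewrite normrM (gtr0_norm h_gt0).
  by rewrite ler_norml; apply/andP; split; lra.
(* The constant is the value at any Lebesgue point; if there is none in []0, l[], almost no point
   has to be treated and 0 serves. *)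
have [[x0 [x0l lx0]]|no] := pselect (exists x, 0 < x < l /\ lebesgue_pt f x).
  exists (f x0); apply: ae_imp (ae_lebesgue_pt lf) => x lx xl.
  exact: key (lx xl) lx0.
exists 0; apply: ae_imp (ae_lebesgue_pt lf) => x lx xl.
by exfalso; apply: no; exists x; split => //; exact: lx.
Qed.

End du_bois_reymond.

(** * Weak derivatives and traces *)

Section weak_derivative.
Context {R : realType}.
Notation mu := (@lebesgue_measure R).
Implicit Types (l : R) (f g u U : R -> R).

Definition aeI l (P : R -> Prop) := \forall x \ae mu, 0 <= x <= l -> P x.

Lemma aeIP l (P : R -> Prop) : (\forall x \ae mu, x \in `[0, l] -> P x) <-> aeI l P.
Proof.
by split; apply: ae_imp => x h xl; apply: h; move: xl; rewrite ?in_itv.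
Qed.

Lemma aeI_all l (P : R -> Prop) : (forall x, 0 <= x <= l -> P x) -> aeI l P.
Proof. by move=> h; apply: aeW. Qed.

Lemma aeI_imp l (P Q : R -> Prop) : (forall x, 0 <= x <= l -> P x -> Q x) ->
  aeI l P -> aeI l Q.
Proof. by move=> h; apply: ae_imp => x hx xl; exact: h (hx xl). Qed.

Lemma aeI_and l (P Q : R -> Prop) : aeI l P -> aeI l Q -> aeI l (fun x => P x /\ Q x).
Proof. by apply: ae_imp2 => x p q xl; split; [exact: p|exact: q]. Qed.

Lemma ae_neq (a : R) : \forall x \ae mu, x != a.
Proof.
exists [set a]; split => //; first exact: lebesgue_measure_set1.
by move=> x /= /negP; rewrite negbK => /eqP.
Qed.

Lemma aeI_open l (P : R -> Prop) : (\forall x \ae mu, 0 < x < l -> P x) -> aeI l P.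
Proof.
move=> h; apply: ae_imp3 h (ae_neq 0) (ae_neq l) => x hx x0 xl /andP[x0' xl'].
by apply: hx; rewrite !lt_neqAle x0' xl' xl eq_sym x0.
Qed.

Lemma aeI_ex l (P : R -> Prop) (a b : R) : aeI l P -> 0 <= a -> a < b -> b <= l ->
  exists2 x, a < x < b & P x.
Proof.
move=> [N [mN N0 hN]] a0 ab bl; apply: contrapT => no.
have sub : `]a, b[ `<=` N.
  move=> x; rewrite /= in_itv/= => xab; apply: hN => /= hx; apply: no; exists x => //.
  by apply: hx; move: xab => /andP[? ?]; apply/andP; split; lra.
have : (mu `]a, b[ <= mu N)%E by apply: le_measure => //; rewrite inE.
rewrite N0 lebesgue_measure_itv/= lte_fin ab -EFinB lee_fin.
by lra.
Qed.

(** A null set contains no interval, so points with [f = g] lie arbitrarily close to [x]; [0 < l]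
    gives the neighbourhoods of [x] in [[0, l]] positive length, also at the end points. *)
Lemma within_ae_eq l f g : 0 < l -> {within `[0, l], continuous f} ->
  {within `[0, l], continuous g} -> aeI l (fun x => f x = g x) ->
  forall x, 0 <= x <= l -> f x = g x.
Proof.
move=> l0 /within_itvP cf /within_itvP cg fg x xl.
apply/eqP; rewrite -subr_eq0 -normr_le0; apply/ler_addgt0Pl => e e0; rewrite addr0.
have e2 : 0 < e / 2 by lra.
have [d d0 hd] := cf x _ xl e2; have [d' d'0 hd'] := cg x _ xl e2.
pose m := Num.min d d'.
have m0 : 0 < m by rewrite lt_min d0.
have [x0 xl'] := andP xl.
have [y /andP[y1 y2] fgy] : exists2 y, Num.max 0 (x - m) < y < Num.min l (x + m) & f y = g y.
  apply: aeI_ex fg _ _ _; first by rewrite le_max lexx.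
    by rewrite lt_min !gt_max l0/=; apply/and3P; split; lra.
  by rewrite ge_min lexx.
move: y1 y2; rewrite gt_max lt_min => /andP[y0 y1] /andP[yl y2].
have yl' : 0 <= y <= l by rewrite !ltW.
have ym : `|y - x| < m by rewrite ltr_norml; apply/andP; split; lra.
have md : m <= d by rewrite /m ge_min lexx.
have md' : m <= d' by rewrite /m ge_min lexx orbT.
have h1 := hd y yl' (lt_le_trans ym md).
have h2 := hd' y yl' (lt_le_trans ym md').
have -> : f x - g x = (g y - g x) - (f y - f x) by rewrite fgy; lra.
by apply: (le_trans (ler_normB _ _)); lra.
Qed.

Lemma int_oo_cc l f : integ l f -> \int[mu]_(x in `]0, l[) f x = \int[mu]_(x in `[0, l]) f x.
Proof.
move=> lf; congr fine; apply/esym; apply: integral_itv_bndoo.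
apply: measurable_funS (measurable_int _ lf) => //.
by move=> x /=; rewrite !in_itv/= => /andP[? ?]; rewrite !ltW.
Qed.

Lemma measurable_cc l f : measurable_fun `]0, l[ f -> measurable_fun `[0, l] f.
Proof.
exact: measurable_fun_itv_cc.
Qed.

Lemma integ_measurable l f : integ l f -> measurable_fun `[0, l] f.
Proof. by move=> /measurable_int/measurable_EFinP. Qed.

Lemma eq_ae_int l f g : measurable_fun `[0, l] f -> measurable_fun `[0, l] g ->
  aeI l (fun x => f x = g x) -> \int[mu]_(x in `[0, l]) f x = \int[mu]_(x in `[0, l]) g x.
Proof.
move=> mf mg fg; congr fine; apply: ae_eq_integral => //.
- exact/measurable_EFinP.
- exact/measurable_EFinP.
- by apply: ae_imp fg => x h /=; rewrite in_itv/= => /h ->.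
Qed.

Lemma integ_le l f g : integ l g -> measurable_fun `[0, l] f ->
  aeI l (fun x => `|f x| <= `|g x|) -> integ l f.
Proof.
move=> /integrableP[mg ig] mf fg; apply/integrableP; split; first exact/measurable_EFinP.
apply: le_lt_trans ig; apply: ae_ge0_le_integral => //.
- by do 2 apply: measurableT_comp => //; exact/measurable_EFinP.
- exact: measurableT_comp.
Qed.

Lemma integ_ae l f g : integ l f -> measurable_fun `[0, l] g ->
  aeI l (fun x => f x = g x) -> integ l g.
Proof. by move=> lf mg fg; apply: integ_le lf mg _; apply: aeI_imp fg => x _ ->. Qed.

Lemma integ_locally l f : integ l f -> locally_integrable `]0, l[ f.
Proof.
move=> lf; apply: open_integrable_locally; first exact: itv_open.
apply: integrableS lf => //.
by move=> x /=; rewrite !in_itv/= => /andP[? ?]; rewrite !ltW.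
Qed.

Lemma test_acd l phi : test_function l phi -> acd l phi (derive1 phi).
Proof.
move=> [dphi cphi _]; split.
  apply: continuous_compact_integrable; first exact: segment_compact.
  exact: continuous_subspaceT.
move=> x /andP[]; rewrite le_eqVlt => /predU1P[<-|x0 xl]; first by rewrite prim0 addr0.
have cphi0 : continuous phi.
  by move=> z; apply/differentiable_continuous/derivable1_diffP.
rewrite /prim /Rintegral (@continuous_FTC2 _ _ phi)//=; first by rewrite [RHS]addrCA subrr addr0.
- exact: continuous_subspaceT.
- split=> //.
  + by apply: cvg_at_right_filter; exact: cphi0.
  + by apply: cvg_at_left_filter; exact: cphi0.
Qed.

Lemma test_end l phi : test_function l phi -> phi 0 = 0 /\ phi l = 0.
Proof.
move=> [_ _ supp]; split; apply: contrapT => /eqP/(@subset_closure _ [set x | phi x != 0])/supp;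
  by rewrite /= in_itv/= ltxx ?andbF.
Qed.

Lemma integM_test l f phi : integ l f -> test_function l phi ->
  integ l (fun x => f x * phi x).
Proof.
move=> lf tphi; apply: eq_integ (integ_contM (acd_within (test_acd tphi)) lf) => x _.
by rewrite mulrC.
Qed.

Lemma integM_dtest l f phi : integ l f -> test_function l phi ->
  integ l (fun x => f x * derive1 phi x).
Proof.
move=> lf [_ cphi _].
have cd : {within `[0, l], continuous (derive1 phi)} by exact: continuous_subspaceT.
by apply: eq_integ (integ_contM cd lf) => x _; rewrite mulrC.
Qed.

Lemma acd_integ l U g : acd l U g -> integ l U.
Proof.
move=> /acd_within cU; apply: continuous_compact_integrable => //.
exact: segment_compact.
Qed.

Lemma acd_by_parts l U g phi : 0 < l -> acd l U g -> test_function l phi ->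
  \int[mu]_(x in `[0, l]) (U x * derive1 phi x) =
  - \int[mu]_(x in `[0, l]) (g x * phi x).
Proof.
move=> l0 aU tphi; have [p0 pl] := test_end tphi.
have := acd_FTC (ltW l0) (acdM aU (test_acd tphi)).
rewrite RintegralD//; last 2 first.
- by apply: integM_test => //; case: aU.
- by apply: integM_dtest => //; exact: acd_integ aU.
by rewrite p0 pl; lra.
Qed.

Lemma acd_is_wderiv l u U g : 0 < l -> acd l U g -> measurable_fun `[0, l] u ->
  aeI l (fun x => u x = U x) -> is_wderiv l u g.
Proof.
move=> l0 aU mu_ uU.
have iu : integ l u.
  by apply: integ_ae (acd_integ aU) mu_ _; apply: aeI_imp uU => x _ ->.
have ig := aU.1.
split; [exact: integ_locally|exact: integ_locally|move=> phi tphi].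
rewrite (int_oo_cc (integM_dtest iu tphi)) (int_oo_cc (integM_test ig tphi)).
rewrite -(acd_by_parts l0 aU tphi); apply: eq_ae_int.
- exact: integ_measurable (integM_dtest iu tphi).
- exact: integ_measurable (integM_dtest (acd_integ aU) tphi).
- by apply: aeI_imp uU => x _ ->.
Qed.

(** [u - prim g] has zero weak derivative, hence equals a constant [c] almost everywhere, and
    [c + prim g] is the representative. *)
Lemma is_wderiv_acd l u g : 0 < l -> is_wderiv l u g -> integ l u -> integ l g ->
  exists2 U, acd l U g & aeI l (fun x => u x = U x).
Proof.
move=> l0 [lu lg ug] iu ig.
have aP : acd l (prim g) g by split => // x _; rewrite prim0 add0r.
have ip := acd_integ aP.
have [c hc] : exists c, \forall x \ae mu, 0 < x < l -> u x - prim g x = c.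
  apply: du_bois_reymond1; first by apply: integ_locally; exact: integB.
  move=> phi tphi.
  under eq_Rintegral do rewrite mulrBl.
  have i1 := integM_dtest iu tphi; have i2 := integM_dtest ip tphi.
  rewrite (int_oo_cc (integB i1 i2)) RintegralB// -(int_oo_cc i1) ug//.
  rewrite (acd_by_parts l0 aP tphi) (int_oo_cc (integM_test ig tphi)).
  by rewrite subrr.
exists (fun x => c + prim g x).
  by split => // x _; rewrite prim0; lra.
by apply: aeI_open; apply: ae_imp hc => x h /h; lra.
Qed.

(** This is what identifies the function picked by [wderiv], about which only [is_wderiv], with its
    local integrability, is known. Products with a test function are integrable because its support
    is compact in []0, l[]. *)
Lemma is_wderiv_unique l u u' g g' : is_wderiv l u g -> is_wderiv l u' g' ->
  aeI l (fun x => u x = u' x) -> aeI l (fun x => g x = g' x).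
Proof.
move=> [lu lg ug] [lu' lg' ug'] uu'.
apply: aeI_open.
have loc phi f : locally_integrable `]0, l[ f -> test_function l phi ->
    mu.-integrable `]0, l[ (EFin \o (fun x => f x * phi x)).
  move=> [mf _ foo] [dphi cphi supp].
  pose K := closure [set x | phi x != 0].
  have cK : compact K.
    apply: (subclosed_compact _ (@segment_compact R 0 l)); first exact: closed_closure.
    by move=> x /supp /=; rewrite !in_itv/= => /andP[? ?]; rewrite !ltW.
  have mK : measurable K by exact: compact_measurable.
  have cp : continuous phi.
    by move=> z; apply/differentiable_continuous/derivable1_diffP.
  have ifK : mu.-integrable K (EFin \o f).
    apply/integrableP; split; last exact: foo.
    by apply/measurable_EFinP; apply: measurable_funS mf.
  have iK : mu.-integrable K (EFin \o (fun x => f x * phi x)).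
    apply: (@integrableMl _ _ _ mu K _ (EFin \o f) phi ifK) => //.
      by apply: measurable_funTS; exact: continuous_measurable_fun.
    have cpK : {within K, continuous phi} by exact: continuous_subspaceT.
    have /compact_bounded[M [Mr hM]] := continuous_compact cpK cK.
    by exists M; split => // N MN z Kz; apply: hM => //; exists z.
  have -> : EFin \o (fun x => f x * phi x) = (EFin \o (fun x => f x * phi x)) \_ K.
    apply/funext => z; rewrite /= patchE; case: ifPn => // /negP zK.
    suff -> : phi z = 0 by rewrite mulr0.
    by apply: contrapT => /eqP pz; apply: zK; rewrite inE; exact: subset_closure.
  apply/(integrable_restrict mu) => //.
  by apply: integrableS iK => //; exact: measurableI.
have mloc phi f : locally_integrable `]0, l[ f -> test_function l phi ->
    measurable_fun `]0, l[ (fun x => f x * derive1 phi x).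
  move=> [mf _ _] [_ cphi _]; apply: measurable_funM => //.
  by apply: measurable_funTS; exact: continuous_measurable_fun.
suff : \forall x \ae mu, 0 < x < l -> g x - g' x = 0.
  by apply: ae_imp => x h /h; lra.
apply: du_bois_reymond0; first exact: locally_integrableB.
move=> phi tphi; under eq_Rintegral do rewrite mulrBl.
rewrite RintegralB//; [|exact: loc|exact: loc].
apply/eqP; rewrite subr_eq0 -eqr_opp -ug// -ug'//; apply/eqP.
congr fine; apply: ae_eq_integral => //.
- by apply/measurable_EFinP; exact: mloc.
- by apply/measurable_EFinP; exact: mloc.
- by apply: ae_imp uu' => x h /=; rewrite in_itv/= => /andP[x0 xl]; rewrite h// !ltW.
Qed.

Lemma wderivE l u g : is_wderiv l u g -> is_wderiv l u (wderiv l u).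
Proof. by move=> ug; apply: (@xgetPex _ (cst 0) [set g | is_wderiv l u g]); exists g. Qed.

Lemma acd_wderiv l u U g : 0 < l -> acd l U g -> measurable_fun `[0, l] u ->
  aeI l (fun x => u x = U x) -> aeI l (fun x => wderiv l u x = g x).
Proof.
move=> l0 aU mu_ uU; have w := acd_is_wderiv l0 aU mu_ uU.
by apply: is_wderiv_unique (wderivE w) w _; exact: aeI_all.
Qed.

Lemma continuous_repE l u U : 0 < l -> {within `[0, l], continuous U} ->
  aeI l (fun x => u x = U x) -> forall x, 0 <= x <= l -> continuous_rep l u x = U x.
Proof.
move=> l0 cU uU x xl.
have [cv vu] : {within `[0, l], continuous (continuous_rep l u)} /\
    \forall x \ae mu, x \in `[0, l] -> continuous_rep l u x = u x.
  apply: (@xgetPex _ (cst 0) [set v | {within `[0, l], continuous v} /\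
    \forall x \ae mu, x \in `[0, l] -> v x = u x]).
  exists U; split => //; apply/aeIP.
  by apply: aeI_imp uU => y _ ->.
apply: within_ae_eq xl => //; move/aeIP : vu => vu.
by apply: ae_imp2 vu uU => y h1 h2 yl; rewrite h1// h2.
Qed.

End weak_derivative.

(** * Convergence along a filter of times *)

Section heine.
Context {R : realType}.

(** Heine's theorem with only [z] confined to the compact [[r, M]]: [y] may leave it, as the values
    at nearby times do. *)
Lemma heine_pos (phi : R -> R) (r M e : R) : 0 < r ->
  (forall y, 0 < y -> {for y, continuous phi}) -> 0 < e ->
  exists2 d, 0 < d & forall z y, r <= z <= M -> `|y - z| < d -> `|phi y - phi z| <= e.
Proof.
move=> r0 cphi e0.
have := @segment_compact R r M; rewrite compact_near_coveringP => cover.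
have /= := cover R (0 : R)^'+ (fun d z => forall y, `|y - z| < d -> `|phi y - phi z| <= e) _.
case=> [z|d /= d0 hd].
  rewrite /= in_itv/= => /andP[rz zM].
  have e2 : 0 < e / 2 by lra.
  have /cvgrPdist_le/(_ (e / 2) e2)/nbhs_ballP[d /= d0 hd] := cphi z (lt_le_trans r0 rz).
  (* Half of the radius is spent on [z'] around [z] and half on [y] around [z'], so that both stay
     where continuity at [z] applies. *)
  exists (ball z (d / 2), [set d' | 0 < d' < d / 2]).
    split => /=; first by apply: nbhsx_ballx; lra.
    exists (d / 2) => /=; first by lra.
    by move=> u; rewrite /ball/= sub0r normrN => ud u0; rewrite u0/= (le_lt_trans (ler_norm u)).
  move=> [z' d'] /= [zz' /andP[d'0 d'd]] y yz'.
  have h1 : `|phi z - phi z'| <= e / 2.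
    by apply: hd; move: zz'; rewrite /ball/=; lra.
  have h2 : `|phi z - phi y| <= e / 2.
    apply: hd; move: zz'; rewrite /ball/= => zz'.
    have -> : z - y = (z - z') - (y - z') by lra.
    by apply: (le_lt_trans (ler_normB _ _)); lra.
  have -> : phi y - phi z' = (phi z - phi z') - (phi z - phi y) by lra.
  by apply: (le_trans (ler_normB _ _)); lra.
have d2 : 0 < d / 2 by lra.
have bd : ball (0 : R) d (d / 2) by rewrite /ball/= sub0r normrN gtr0_norm//; lra.
exists (d / 2) => // z y rz yz; exact: (hd (d / 2) bd d2 z).
Qed.

(** By the mean value theorem the remainder is [(phi' w - phi' z) * (y - z)] with [w] between [y]
    and [z], and [heine_pos] bounds the first factor. *)
Lemma heine_derive (phi phi' : R -> R) (r M e : R) : 0 < r ->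
  (forall y : R, 0 < y -> is_derive y 1 phi (phi' y)) ->
  (forall y, 0 < y -> {for y, continuous phi'}) -> 0 < e ->
  exists2 d, 0 < d & forall z y, r <= z <= M -> `|y - z| < d ->
    `|phi y - phi z - phi' z * (y - z)| <= e * `|y - z|.
Proof.
move=> r0 dphi cphi' e0; have [d d0 hd] := heine_pos M r0 cphi' e0.
(* The bound [r] on the distance keeps [y] positive, where [phi] is differentiable. *)
exists (Num.min d r); first by rewrite lt_min d0.
move=> z y /andP[rz zM]; rewrite lt_min => /andP[yd yr].
have z0 : 0 < z by lra.
have y0 : 0 < y by move: yr; rewrite ltr_norml => /andP[]; lra.
have [w [wyz ->]] : exists w, `|w - z| <= `|y - z| /\ phi y - phi z = phi' w * (y - z).
  have cphi u v : 0 < u -> {within `[u, v], continuous phi}.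
    move=> u0; apply: derivable_within_continuous => x; rewrite in_itv/= => /andP[ux _].
    by apply: ex_derive; apply: dphi; lra.
  have [yz|zy|->] := ltrgtP y z.
  - have [|w|w] := @MVT _ phi phi' y z yz.
    + by move=> x; rewrite in_itv/= => /andP[xy _]; apply: dphi; lra.
    + exact: cphi.
    rewrite in_itv/= => /andP[yw wz] h; exists w; split; last lra.
    by rewrite !ltr0_norm; lra.
  - have [|w|w] := @MVT _ phi phi' z y zy.
    + by move=> x; rewrite in_itv/= => /andP[xy _]; apply: dphi; lra.
    + exact: cphi.
    rewrite in_itv/= => /andP[yw wz] h; exists w; split; last lra.
    by rewrite !gtr0_norm; lra.
  - by exists z; rewrite !subrr normr0 mulr0.
rewrite -mulrBl normrM ler_wpM2r// hd ?rz//.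
exact: le_lt_trans wyz yd.
Qed.

End heine.

Section convergence.
Context {R : realType}.
Notation mu := (@lebesgue_measure R).
Implicit Types (l : R) (F : set_system R).

(* Convergence in L^oo(0, l), of measurable functions to a bounded limit. *)
Record aeu F l (f : R -> R -> R) (f0 : R -> R) : Prop := Aeu {
  aeu_near : \forall s \near F, measurable_fun `[0, l] (f s) ;
  aeu_meas : measurable_fun `[0, l] f0 ;
  aeu_bounded : exists2 M, 0 < M & aeI l (fun x => `|f0 x| <= M) ;
  aeu_cvg : forall e, 0 < e ->
    \forall s \near F, aeI l (fun x => `|f s x - f0 x| <= e) }.

(** The weaker mode of convergence is there for the difference quotients of [m], which are
    controlled in [L^2] only. *)
Record L1c F l (f : R -> R -> R) (f0 : R -> R) : Prop := L1C {
  L1c_near : \forall s \near F, integ l (f s) ;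
  L1c_integ : integ l f0 ;
  L1c_cvg : forall e, 0 < e ->
    \forall s \near F, \int[mu]_(x in `[0, l]) `|f s x - f0 x| <= e }.

Context {F : set_system R} {FF : ProperFilter F}.

Lemma aeu_cst l (f0 : R -> R) M : measurable_fun `[0, l] f0 -> aeI l (fun x => `|f0 x| <= M) ->
  aeu F l (fun=> f0) f0.
Proof.
move=> mf0 f0M; split=> //; first exact: nearW.
- exists (`|M| + 1); first by rewrite ltr_wpDl.
  by apply: aeI_imp f0M => x _ h; rewrite (le_trans h)// (le_trans (ler_norm M))// lerDl.
- by move=> e e0; apply: nearW => s; apply: aeI_all => x _; rewrite subrr normr0 ltW.
Qed.

Lemma aeu_scalar l (k : R) : aeu F l (fun _ _ => k) (fun=> k).
Proof. by apply: (@aeu_cst _ _ `|k|) => //; exact: aeI_all. Qed.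

Lemma aeuD l f g f0 g0 : aeu F l f f0 -> aeu F l g g0 ->
  aeu F l (fun s x => f s x + g s x) (fun x => f0 x + g0 x).
Proof.
move=> [nf mf [M M0 bf] cf] [ng mg [N N0 bg] cg]; split.
- by apply: filterS2 nf ng => s; exact: measurable_funD.
- exact: measurable_funD.
- exists (M + N); first exact: addr_gt0.
  apply: aeI_imp (aeI_and bf bg) => x _ [h1 h2].
  by apply: (le_trans (ler_normD _ _)); exact: lerD.
- move=> e e0; have e2 : 0 < e / 2 by lra.
  apply: filterS2 (cf _ e2) (cg _ e2) => s h1 h2.
  apply: aeI_imp (aeI_and h1 h2) => x _ [h3 h4].
  by rewrite opprD addrACA; apply: (le_trans (ler_normD _ _)); lra.
Qed.

Lemma aeuM l f g f0 g0 : aeu F l f f0 -> aeu F l g g0 ->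
  aeu F l (fun s x => f s x * g s x) (fun x => f0 x * g0 x).
Proof.
move=> [nf mf [M M0 bf] cf] [ng mg [N N0 bg] cg]; split.
- by apply: filterS2 nf ng => s; exact: measurable_funM.
- exact: measurable_funM.
- exists (M * N); first exact: mulr_gt0.
  apply: aeI_imp (aeI_and bf bg) => x _ [h1 h2].
  by rewrite normrM ler_pM.
- move=> e e0.
  (* The cap at 1 absorbs the product of the two errors: the total is at most [e1 * (1 + N + M)]. *)
  pose e1 := Num.min 1 (e / (M + N + 1)).
  have MN : 0 < M + N + 1 by lra.
  have e10 : 0 < e1 by rewrite lt_min ltr01 divr_gt0.
  have e11 : e1 <= 1 by rewrite ge_min lexx.
  have e1e : e1 * (M + N + 1) <= e by rewrite -ler_pdivlMr// ge_min lexx orbT.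
  apply: filterS2 (cf _ e10) (cg _ e10) => s h1 h2.
  apply: aeI_imp (aeI_and (aeI_and h1 h2) (aeI_and bf bg)) => x _ [[h3 h4] [h5 h6]].
  have -> : f s x * g s x - f0 x * g0 x =
    (f s x - f0 x) * (g s x - g0 x) + (f s x - f0 x) * g0 x + f0 x * (g s x - g0 x) by ring.
  apply: le_trans e1e.
  apply: (le_trans (ler_normD _ _)); apply: (le_trans (lerD (ler_normD _ _) (lexx _))).
  rewrite !normrM.
  have -> : e1 * (M + N + 1) = e1 * 1 + e1 * N + M * e1 by ring.
  by apply: lerD; [apply: lerD|]; apply: ler_pM => //; lra.
Qed.

Lemma aeu_comp l f f0 (phi : R -> R) r : 0 < r -> measurable_fun setT phi ->
  (forall y, 0 < y -> {for y, continuous phi}) ->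
  aeu F l f f0 -> aeI l (fun x => r <= f0 x) ->
  aeu F l (fun s x => phi (f s x)) (fun x => phi (f0 x)).
Proof.
move=> r0 mphi cphi [nf mf [M M0 bf] cf] rf; split.
- by apply: filterS nf => s; exact: (measurableT_comp mphi).
- exact: (measurableT_comp mphi).
- have cM : {within `[r, M], continuous phi}.
    by apply: continuous_in_subspaceT => y; rewrite inE/= in_itv/= => /andP[ry _]; apply: cphi; lra.
  have /compact_bounded[N [_ hN]] := continuous_compact cM (@segment_compact R r M).
  exists (`|N| + 1); first by rewrite ltr_wpDl.
  apply: aeI_imp (aeI_and rf bf) => x _ [rx xM].
  apply: (hN (`|N| + 1)); first by rewrite (le_lt_trans (ler_norm N))// ltrDl.
  by exists (f0 x) => //; rewrite /= in_itv/= rx (le_trans (ler_norm _)).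
- move=> e e0; have [d d0 hd] := heine_pos M r0 cphi e0.
  have d2 : 0 < d / 2 by lra.
  apply: filterS (cf _ d2) => s h.
  apply: aeI_imp (aeI_and h (aeI_and rf bf)) => x _ [h1 [h2 h3]].
  by apply: hd; [rewrite h2 (le_trans (ler_norm _))|lra].
Qed.

(* [k s] stands for the inverse of a time increment. *)
Lemma aeu_chain l f f0 q0 (k : R -> R) (phi phi' : R -> R) r : 0 < r ->
  measurable_fun setT phi -> measurable_fun setT phi' ->
  (forall y : R, 0 < y -> is_derive y 1 phi (phi' y)) ->
  (forall y, 0 < y -> {for y, continuous phi'}) ->
  aeu F l f f0 -> aeI l (fun x => r <= f0 x) ->
  aeu F l (fun s x => (f s x - f0 x) * k s) q0 ->
  aeu F l (fun s x => (phi (f s x) - phi (f0 x)) * k s) (fun x => phi' (f0 x) * q0 x).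
Proof.
move=> r0 mphi mphi' dphi cphi' hf rf hq.
have h1 : aeu F l (fun s x => phi' (f0 x) * ((f s x - f0 x) * k s)) (fun x => phi' (f0 x) * q0 x).
  apply: aeuM => //.
  have [_ mf [M M0 bf] _] := aeu_comp r0 mphi' cphi' hf rf.
  exact: (aeu_cst mf bf).
have [_ mp [M M0 bp] cp] := h1; split => //.
- apply: filterS (aeu_near hf) => s ms; apply: measurable_funM => //.
  apply: measurable_funB; first exact: (measurableT_comp mphi).
  by apply: (measurableT_comp mphi); exact: aeu_meas hf.
- by exists M.
- move=> e e0.
  have [Q Q0 bq] := aeu_bounded hq.
  have [N N0 bf] := aeu_bounded hf.
  have e2 : 0 < e / 2 by lra.
  (* Once the quotient [(f s x - f0 x) * k s] is within 1 of [q0 x], it is bounded by [Q + 1];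
     multiplied by [k s], the first-order remainder of [phi] is then at most [e / 2]. *)
  have e3 : 0 < e / 2 / (Q + 1) by rewrite divr_gt0//; lra.
  have [d d0 hd] := heine_derive N r0 dphi cphi' e3.
  have d2 : 0 < d / 2 by lra.
  apply: filterS3 (cp _ e2) (aeu_cvg hq ltr01) (aeu_cvg hf d2) => s a1 a2 a3.
  apply: aeI_imp (aeI_and (aeI_and a1 a2) (aeI_and (aeI_and a3 rf) (aeI_and bq bf))).
  move=> x _ [[b1 b2] [[b3 b4] [b5 b6]]].
  have -> : (phi (f s x) - phi (f0 x)) * k s - phi' (f0 x) * q0 x =
    (phi (f s x) - phi (f0 x) - phi' (f0 x) * (f s x - f0 x)) * k s +
    (phi' (f0 x) * ((f s x - f0 x) * k s) - phi' (f0 x) * q0 x) by ring.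
  apply: (le_trans (ler_normD _ _)).
  suff : `|(phi (f s x) - phi (f0 x) - phi' (f0 x) * (f s x - f0 x)) * k s| <= e / 2 by lra.
  have b7 : `|(f s x - f0 x) * k s| <= Q + 1.
    have -> : (f s x - f0 x) * k s = q0 x + ((f s x - f0 x) * k s - q0 x) by ring.
    by apply: (le_trans (ler_normD _ _)); lra.
  rewrite normrM; apply: (@le_trans _ _ (e / 2 / (Q + 1) * `|f s x - f0 x| * `|k s|)).
    apply: ler_wpM2r => //; apply: hd; last lra.
    by rewrite b4 (le_trans (ler_norm _)).
  rewrite -mulrA -normrM -ler_pdivlMl//.
  by have -> : (e / 2 / (Q + 1))^-1 * (e / 2) = Q + 1 by field; rewrite !lt0r_neq0//; lra.
Qed.

Lemma aeu_integ l f f0 : aeu F l f f0 -> integ l f0.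
Proof.
move=> [_ mf [M M0 bf] _]; apply: integ_le (integ_cst l M) mf _.
by apply: aeI_imp bf => x _; rewrite /cst (gtr0_norm M0).
Qed.

Lemma ae_le_int l (f g : R -> R) : integ l f -> integ l g -> aeI l (fun x => f x <= g x) ->
  \int[mu]_(x in `[0, l]) f x <= \int[mu]_(x in `[0, l]) g x.
Proof.
move=> lf lg fg; rewrite -subr_ge0 -RintegralB//.
have -> : \int[mu]_(x in `[0, l]) (g x - f x) = \int[mu]_(x in `[0, l]) `|g x - f x|.
  apply: eq_ae_int; first exact: integ_measurable (integB lg lf).
  - exact: integ_measurable (integ_norm (integB lg lf)).
  - by apply: aeI_imp fg => x _ h; rewrite ger0_norm// subr_ge0.
by apply: Rintegral_ge0.
Qed.

Lemma int_cst l (k : R) : 0 < l -> \int[mu]_(x in `[0, l]) cst k x = k * l.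
Proof.
move=> l0; rewrite Rintegral_cst//; congr (_ * _).
have E : mu `[0, l] = l%:E by rewrite lebesgue_measure_itv/= lte_fin l0 oppr0 adde0.
exact: (congr1 fine E).
Qed.

Lemma aeu_L1c l f f0 : 0 < l -> aeu F l f f0 -> L1c F l f f0.
Proof.
move=> l0 hf; have if0 := aeu_integ hf.
have int1 : \forall s \near F, integ l (f s).
  apply: filterS2 (aeu_near hf) (aeu_cvg hf ltr01) => s ms h.
  have [M M0 bf] := aeu_bounded hf.
  apply: integ_le (integ_cst l (M + 1)) ms _.
  have M1 : 0 <= M + 1 by lra.
  apply: aeI_imp (aeI_and h bf) => x _ [h1 h2]; rewrite /cst (ger0_norm M1).
  by rewrite -(subrK (f0 x) (f s x)); apply: (le_trans (ler_normD _ _)); lra.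
split=> // e e0; have el : 0 < e / l by exact: divr_gt0.
apply: filterS2 int1 (aeu_cvg hf el) => s is_ h.
have -> : e = \int[mu]_(x in `[0, l]) cst (e / l) x.
  by rewrite int_cst//; field; rewrite lt0r_neq0.
apply: ae_le_int => //; first exact/integ_norm/integB.
exact: integ_cst.
Qed.

Lemma L1cD l f g f0 g0 : L1c F l f f0 -> L1c F l g g0 ->
  L1c F l (fun s x => f s x + g s x) (fun x => f0 x + g0 x).
Proof.
move=> [nf if0 cf] [ng ig0 cg]; split.
- by apply: filterS2 nf ng => s; exact: integD.
- exact: integD.
- move=> e e0; have e2 : 0 < e / 2 by lra.
  near=> s.
  have fs : integ l (f s) by near: s.
  have gs : integ l (g s) by near: s.
  apply: (@le_trans _ _ (\int[mu]_(x in `[0, l]) (`|f s x - f0 x| + `|g s x - g0 x|))).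
    apply: ae_le_int.
    + by apply/integ_norm/integB; exact: integD.
    + by apply: integD; exact/integ_norm/integB.
    + by apply: aeI_all => x _; rewrite opprD addrACA; exact: ler_normD.
  rewrite RintegralD//; [|exact/integ_norm/integB|exact/integ_norm/integB].
  have : \int[mu]_(x in `[0, l]) `|f s x - f0 x| <= e / 2 by near: s; exact: cf.
  have : \int[mu]_(x in `[0, l]) `|g s x - g0 x| <= e / 2 by near: s; exact: cg.
  by lra.
Unshelve. all: by end_near. Qed.

(** The error splits as [f * (g - g0) + (f - f0) * g0]: the first term is controlled by the eventual
    bound [M + 1] on [f], the second by the integral of [|g0|]. *)
Lemma L1cM l f g f0 g0 : aeu F l f f0 -> L1c F l g g0 ->
  L1c F l (fun s x => f s x * g s x) (fun x => f0 x * g0 x).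
Proof.
move=> hf [ng ig0 cg].
have [M M0 bf] := aeu_bounded hf.
have bM (h k : R -> R) N : measurable_fun `[0, l] h -> integ l k ->
    aeI l (fun x => `|h x| <= N) -> integ l (fun x => h x * k x).
  move=> mh ik hN; apply: integ_le (integZ N ik) _ _.
    by apply: measurable_funM => //; exact: integ_measurable.
  apply: aeI_imp hN => x _ h1; rewrite !normrM ler_wpM2r//.
  exact: le_trans h1 (ler_norm _).
have bfs : \forall s \near F, aeI l (fun x => `|f s x| <= M + 1).
  apply: filterS (aeu_cvg hf ltr01) => s h; apply: aeI_imp (aeI_and h bf) => x _ [h1 h2].
  by rewrite -(subrK (f0 x) (f s x)); apply: (le_trans (ler_normD _ _)); lra.
have nfg : \forall s \near F, integ l (fun x => f s x * g s x).
  by apply: filterS3 (aeu_near hf) ng bfs => s; exact: bM.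
have ifg : integ l (fun x => f0 x * g0 x) by apply: bM bf => //; exact: aeu_meas hf.
split=> // e e0.
pose G := \int[mu]_(x in `[0, l]) `|g0 x|.
have G0 : 0 <= G by exact: Rintegral_ge0.
have e1 : 0 < e / 2 / (M + 1) by rewrite !divr_gt0//; lra.
have e2 : 0 < e / 2 / (G + 1) by rewrite !divr_gt0//; lra.
near=> s.
have gs : integ l (g s) by near: s.
have i1 : integ l (fun x => `|g s x - g0 x|) by exact/integ_norm/integB.
have i2 : integ l (fun x => `|g0 x|) by exact/integ_norm.
apply: (@le_trans _ _ (\int[mu]_(x in `[0, l])
    ((M + 1) * `|g s x - g0 x| + (e / 2 / (G + 1)) * `|g0 x|))).
  apply: ae_le_int.
  - by apply/integ_norm/integB => //; near: s.
  - by apply: integD; exact: integZ.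
  - have h1 : aeI l (fun x => `|f s x| <= M + 1) by near: s.
    have h2 : aeI l (fun x => `|f s x - f0 x| <= e / 2 / (G + 1)).
      by near: s; exact: (aeu_cvg hf e2).
    apply: aeI_imp (aeI_and h1 h2) => x _ [h3 h4].
    have -> : f s x * g s x - f0 x * g0 x = f s x * (g s x - g0 x) + (f s x - f0 x) * g0 x.
      by ring.
    apply: (le_trans (ler_normD _ _)); rewrite !normrM.
    by apply: lerD; apply: ler_wpM2r.
rewrite RintegralD//; [|exact: integZ|exact: integZ].
rewrite !RintegralZl//.
have : \int[mu]_(x in `[0, l]) `|g s x - g0 x| <= e / 2 / (M + 1) by near: s; exact: cg.
rewrite -/G ler_pdivlMr; last lra.
have : e / 2 / (G + 1) * G <= e / 2.
  by rewrite mulrAC ler_pdivrMr ?ltr_wpDl// ler_wpM2l//; lra.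
by lra.
Unshelve. all: by end_near. Qed.

Lemma L1c_int l f f0 : L1c F l f f0 ->
  \int[mu]_(x in `[0, l]) f s x @[s --> F] --> \int[mu]_(x in `[0, l]) f0 x.
Proof.
move=> [nf if0 cf]; apply/cvgrPdist_le => e e0.
apply: filterS2 nf (cf e e0) => s fs h.
rewrite distrC -RintegralB//; apply: le_trans h.
by apply: le_normr_Rintegral => //; exact: integB.
Qed.

End convergence.

(** * Norms of network functions *)

Section norms.
Context {R : realType}.
Notation mu := (@lebesgue_measure R).
Implicit Types (l : R) (f g : R -> R).

(** The norm of exponent [+oo] unfolds to an essential supremum only when the whole space has
    positive measure. *)
Lemma mu_setT_gt0 : (0 < mu [set: R])%E.
Proof.
apply: (@lt_le_trans _ _ (mu `[0, 1])).
  by rewrite lebesgue_measure_itv/= lte_fin ltr01 oppr0 adde0 lte_fin.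
by apply: le_measure => //; rewrite inE.
Qed.

(** The embedding of [L^2(0, l)] into [L^1(0, l)]: Hölder's inequality against the indicator of
    [[0, l]], whose [L^2] norm is finite and independent of [f]. *)
Lemma Lnorm2_int l : exists2 C, 0 < C & forall f e, 0 <= e ->
  measurable_fun `[0, l] f ->
  ('N[mu]_2%:E[EFin \o (f \_ `[0%R, l])] <= e%:E)%E ->
  integ l f /\ \int[mu]_(x in `[0, l]) `|f x| <= C * e.
Proof.
pose D := ('N[mu]_2%:E[EFin \o \1_(`[0%R, l]%classic : set R)])%E.
have D0 : (0 <= D)%E by exact: Lnorm_ge0.
have Dfin : D \is a fin_num.
  rewrite ge0_fin_numE// /D unlock; apply: poweR_lty.
  rewrite [X in (X < _)%E](_ : _ = mu `[0, l]).
    by rewrite lebesgue_measure_itv; case: ifP => _; rewrite ?ltry.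
  transitivity (\int[mu]_x (\1_(`[0%R, l]%classic : set R) x)%:E)%E; last first.
    by rewrite integral_indic// setIT.
  apply: eq_integral => x _.
  rewrite /= indicE; case: (x \in _); rewrite /= ?normr1 ?normr0.
    by rewrite powR1.
  by rewrite powR0.
(* Adding 1 makes the constant positive even if the interval is null. *)
exists (fine D + 1); first by rewrite ltr_wpDl// fine_ge0.
move=> f e e0 mf fe.
have mfI : measurable_fun [set: R] (f \_ `[0, l]).
  by apply/(measurable_restrictT _ _).1.
have m1 : measurable_fun [set: R] (\1_(`[0%R, l]%classic : set R) : R -> R).
  by apply: measurable_indic.
have := @hoelder _ _ _ mu _ _ 2 2 mfI m1 (ltr0n _ 2) (ltr0n _ 2).
have -> : 2^-1 + 2^-1 = 1 :> R by lra.
move=> /(_ erefl); rewrite -/D Lnorm1.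
have -> : (\int[mu]_x `|(EFin \o (f \_ `[0%R, l] \* \1_(`[0%R, l]%classic))%R) x|)%E =
  (\int[mu]_(x in `[0%R, l]) `|f x|%:E)%E.
  rewrite [RHS]integral_mkcond; apply: eq_integral => x _.
  rewrite /= patchE indicE [in RHS]patchE.
  by case: (x \in _); rewrite /= ?mulr1 ?mulr0// normr0.
move=> h.
have h2 : (\int[mu]_(x in `[0%R, l]) `|f x|%:E <= (fine D * e)%:E)%E.
  apply: (le_trans h); rewrite EFinM fineK// muleC.
  by apply: lee_wpmul2l.
have i : integ l f.
  apply/integrableP; split; first exact/measurable_EFinP.
  by apply: (le_lt_trans h2); rewrite ltry.
split=> //.
apply: (@le_trans _ _ (fine D * e)); last by rewrite ler_wpM2r// lerDl.
rewrite -lee_fin /Rintegral fineK//.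
apply: integrable_fin_num => //.
exact: (integ_norm i).
Qed.

Lemma Lnormoo_ae l f (e : R) : ('N[mu]_+oo[EFin \o (f \_ `[0%R, l])] <= e%:E)%E ->
  aeI l (fun x => `|f x| <= e).
Proof.
rewrite unlock mu_setT_gt0 => /ess_supP.
apply: ae_imp => x /=; rewrite patchE => + xl.
by rewrite mem_set ?lee_fin//= in_itv.
Qed.

End norms.

Section network_norms.
Context {R : realType} {G : network R}.
Notation mu := (@lebesgue_measure R).
Implicit Types (u v : netfun G) (e : edge G).

Lemma in_Lp_measurable (p : \bar R) u e : in_Lp p u -> measurable_fun `[0, len e] (u e).
Proof.
move=> /(_ e) /andP[]; rewrite inE/= => mu_ _.
by apply/(measurable_restrictT _ _).2.
Qed.

Lemma in_L2_integ u e : in_Lp 2%:E u -> integ (len e) (u e).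
Proof.
move=> hu; have [C C0 hC] := Lnorm2_int (len e).
have mu_ := in_Lp_measurable (e := e) hu.
have := hu e => /andP[_]; rewrite inE/= /finite_norm.
case N : ('N[_]_2%:E[_])%E => [r| |] // _; last first.
  by have := Lnorm_ge0 mu 2%:E (EFin \o (u e \_ `[0, len e])); rewrite N.
have r0 : 0 <= r by rewrite -lee_fin -N Lnorm_ge0.
by apply: (hC (u e) r r0 mu_ _).1; rewrite N.
Qed.

Lemma in_Loo_bounded u e : in_Lp +oo%E u ->
  exists2 M, 0 < M & aeI (len e) (fun x => `|u e x| <= M).
Proof.
move=> hu.
have := hu e => /andP[_]; rewrite inE/= /finite_norm.
case N : ('N[_]_+oo[_])%E => [r| |] // _; last first.
  by have := Lnorm_ge0 mu +oo%E (EFin \o (u e \_ `[0, len e])); rewrite N.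
exists (`|r| + 1); first by rewrite ltr_wpDl.
have : ('N[mu]_+oo[EFin \o (u e \_ `[0%R, len e])] <= r%:E)%E by rewrite N.
move=> /Lnormoo_ae; apply: aeI_imp => x _ h.
by rewrite (le_trans h)// (le_trans (ler_norm r))// lerDl.
Qed.

Lemma edge_norm_ge0 (p : \bar R) u e : (0 <= edge_norm p u e)%E.
Proof. exact: Lnorm_ge0. Qed.

Lemma edge_norm_Loo u e : (edge_norm +oo u e <= norm_Loo u)%E.
Proof. exact: le_bigmax. Qed.

Lemma le_poweR_half (x y : \bar R) : (0 <= x)%E -> (x `^ 2 <= y)%E -> (x <= y `^ 2^-1)%E.
Proof.
move=> x0 xy; rewrite -[leLHS](poweRe1 x0) -[X in (x `^ X)%E](@mulfV _ (2 : R))// poweRrM.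
apply: gt0_ler_poweR => //.
- by rewrite in_itv/= leey poweR_ge0.
- by rewrite in_itv/= leey (le_trans _ xy)// poweR_ge0.
Qed.

Lemma norm_L2_ge0 u : (0 <= norm_L2 u)%E.
Proof. exact: poweR_ge0. Qed.

Lemma edge_norm_L2 u e : (edge_norm 2%:E u e <= norm_L2 u)%E.
Proof.
apply: le_poweR_half; first exact: edge_norm_ge0.
rewrite (bigD1 e)//= leeDl// sume_ge0// => i _; exact: poweR_ge0.
Qed.

Lemma norm_H2_L2 u : [/\ (norm_L2 u <= norm_H2 u)%E, (norm_L2 (dx u) <= norm_H2 u)%E &
  (norm_L2 (dx (dx u)) <= norm_H2 u)%E].
Proof.
split; apply: le_poweR_half; rewrite ?norm_L2_ge0//.
- by rewrite -addeA leeDl// adde_ge0// poweR_ge0.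
- by rewrite addeAC leeDr// adde_ge0// poweR_ge0.
- by rewrite leeDr// adde_ge0// poweR_ge0.
Qed.

End network_norms.

(** * The Sobolev embedding on an interval *)

Section h1.
Context {R : realType}.
Notation mu := (@lebesgue_measure R).
Implicit Types (l : R) (f g u U : R -> R).

(* For [0 < l] this means that [u] and its weak derivative [g] are in
   L^1(0, l). *)
Definition h1 l u g := measurable_fun `[0, l] u /\
  exists2 U, acd l U g & aeI l (fun x => u x = U x).

Lemma acd_ae l U g g' : acd l U g -> measurable_fun `[0, l] g' ->
  aeI l (fun x => g x = g' x) -> acd l U g'.
Proof.
move=> [ig Ug] mg' gg'; have ig' := integ_ae ig mg' gg'.
split=> // x xl; rewrite Ug//; congr (_ + _).
have [x0 xl'] := andP xl.
have sub : `[0, x] `<=` `[0, l].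
  by move=> y /=; rewrite !in_itv/= => /andP[? ?]; apply/andP; split; lra.
apply: eq_ae_int.
- by apply: measurable_funS sub _ => //; exact: integ_measurable.
- exact: measurable_funS sub _.
- by apply: ae_imp gg' => y h /andP[y0 yx]; apply: h; rewrite y0 (le_trans yx).
Qed.

Lemma h1_integ l u g : h1 l u g -> integ l u /\ integ l g.
Proof.
move=> [mu_ [U aU uU]]; split; last by case: aU.
by apply: integ_ae (acd_integ aU) mu_ _; apply: aeI_imp uU => x _ ->.
Qed.

Lemma h1_is_wderiv l u g : 0 < l -> h1 l u g -> is_wderiv l u g.
Proof. by move=> l0 [mu_ [U aU uU]]; exact: acd_is_wderiv aU mu_ uU. Qed.

Lemma h1_wderiv l u g : 0 < l -> h1 l u g ->
  h1 l u (wderiv l u) /\ aeI l (fun x => wderiv l u x = g x).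
Proof.
move=> l0 hu; have [mu_ [U aU uU]] := hu.
have wE := acd_wderiv l0 aU mu_ uU; split=> //.
have [_ [mw _ _] _] := wderivE (h1_is_wderiv l0 hu).
split=> //; exists U => //; apply: acd_ae aU (measurable_cc mw) _.
by apply: aeI_imp wE => x _ ->.
Qed.

Lemma h1B l u v g h : h1 l u g -> h1 l v h ->
  h1 l (fun x => u x - v x) (fun x => g x - h x).
Proof.
move=> [mu_ [U aU uU]] [mv [V aV vV]]; split; first exact: measurable_funB.
exists (fun x => 1 * U x + -1 * V x).
  by apply: eq_acd (acd_lin 1 (-1) aU aV) => x _; lra.
by apply: aeI_imp (aeI_and uU vV) => x _ [-> ->]; lra.
Qed.

Lemma h1_ae l u v g : h1 l u g -> measurable_fun `[0, l] v ->
  aeI l (fun x => v x = u x) -> h1 l v g.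
Proof.
move=> [mu_ [U aU uU]] mv vu; split=> //; exists U => //.
by apply: aeI_imp (aeI_and uU vu) => x _ [<- ->].
Qed.

(** The continuous representative satisfies [|U x| <= |U y|] plus the integral of [|g|], for every
    [y]; averaging over [y] gives the bound. *)
Lemma h1_sup l u g : 0 < l -> h1 l u g -> aeI l (fun x => `|u x| <=
  l^-1 * \int[mu]_(y in `[0, l]) `|u y| + \int[mu]_(y in `[0, l]) `|g y|).
Proof.
move=> l0 hu; have [iu ig] := h1_integ hu; have [mu_ [U aU uU]] := hu.
have iU := acd_integ aU; have uU' := uU.
apply: aeI_imp uU => x xl ->.
have ign := integ_norm ig.
set I := \int[mu]_(y in _) `|g y|.
have osc y z : 0 <= y -> y <= z -> z <= l -> `|U z - U y| <= I.
  move=> y0 yz zl.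
  have -> : U z - U y = prim g z - prim g y.
    have [_ Ug] := aU.
    by rewrite (Ug z) ?(Ug y); lra.
  rewrite (prim_sub ig)//.
  apply: (le_trans (norm_int_le ig ign _ _ _)) => //.
  rewrite -(prim_sub ign)//.
  have := prim_le ign (fun s => normr_ge0 (g s)) (lexx 0) y0 (le_trans yz zl).
  have := prim_le ign (fun s => normr_ge0 (g s)) (le_trans y0 yz) zl (lexx l).
  by rewrite prim0 /I /prim; lra.
have Uxy y : 0 <= y <= l -> `|U x| <= `|U y| + I.
  move=> /andP[y0 yl]; have [x0 xl'] := andP xl.
  rewrite -[U x](subrK (U y)); apply: (le_trans (ler_normD _ _)).
  rewrite addrC lerD2l.
  by have [xy|/ltW yx] := leP x y; [rewrite distrC|]; exact: osc.
have : \int[mu]_(y in `[0, l]) cst `|U x| y <= \int[mu]_(y in `[0, l]) (`|U y| + cst I y).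
  apply: ae_le_int; [exact: integ_cst| |exact: aeI_all].
  by apply: integD; [exact: integ_norm|exact: integ_cst].
rewrite RintegralD//; [|exact: integ_norm|exact: integ_cst].
rewrite !int_cst//.
have <- : \int[mu]_(y in `[0, l]) `|u y| = \int[mu]_(y in `[0, l]) `|U y|.
  apply: eq_ae_int; [exact: integ_measurable (integ_norm iu)
    |exact: integ_measurable (integ_norm iU)|].
  by apply: aeI_imp uU' => y _ ->.
by move=> h; rewrite -(ler_pM2r l0) [(_ + I) * l]mulrDl mulrAC mulVf ?lt0r_neq0// mul1r.
Qed.

End h1.

(** * From convergence in the norms of the network spaces to edgewise convergence *)

Section network_convergence.
Context {R : realType} {G : network R}.
Notation mu := (@lebesgue_measure R).
Implicit Types (u v : netfun G) (e : edge G).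

Lemma in_H1_h1 u e : in_H1 u -> h1 (len e) (u e) (dx u e).
Proof.
move=> [hu [g hg w]].
have iu := in_L2_integ e hu; have ig := in_L2_integ e hg.
have [U aU uU] := is_wderiv_acd (len_gt0 e) (w e) iu ig.
have h : h1 (len e) (u e) (g e) by split; [exact: integ_measurable iu|exists U].
exact: (h1_wderiv (len_gt0 e) h).1.
Qed.

Section at_time.
Variables (T t : R) (tT : t \in `[0, T]).
Let F := within `[0, T] (nbhs t).

Lemma within_PF : ProperFilter F.
Proof.
apply: within_nbhs_proper; apply: subset_closure.
by rewrite /= tT.
Qed.

Lemma near_in : \forall s \near F, s \in `[0, T].
Proof. by rewrite /F near_withinE; exact: nearW. Qed.

Lemma C0_Loo_aeu (u : R -> netfun G) e : C0_in (@in_Lp R G +oo) (@norm_Loo R G) T u ->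
  aeu F (len e) (fun s => u s e) (u t e).
Proof.
have FF := within_PF.
move=> [hu cu]; split.
- by apply: filterS near_in => s /hu us; exact: in_Lp_measurable us.
- exact: in_Lp_measurable (hu t tT).
- exact: in_Loo_bounded (hu t tT).
- move=> d d0.
  have : \forall s \near F, (norm_Loo (fun e x => u s e x - u t e x)%R < d%:E)%E.
    exact: (cvge0_lt (cu t tT) d0).
  apply: filterS => s hs.
  apply: Lnormoo_ae; apply: le_trans (ltW hs).
  exact: edge_norm_Loo (fun e x => u s e x - u t e x) e.
Qed.

Lemma L2_near_small (u : R -> netfun G) e (N : R -> \bar R) (F' : set_system R) :
  Filter F' -> (\forall s \near F', measurable_fun `[0, len e] (u s e)) ->
  (\forall s \near F', (norm_L2 (u s) <= N s)%E) -> N s @[s --> F'] --> 0%E ->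
  forall d, 0 < d -> \forall s \near F',
    integ (len e) (u s e) /\ \int[mu]_(x in `[0, len e]) `|u s e x| <= d.
Proof.
move=> FF mu_ uN N0 d d0.
have [C C0 hC] := Lnorm2_int (len e).
have dC : 0 < d / C by exact: divr_gt0.
apply: filterS3 mu_ uN (cvge0_lt N0 dC) => s ms us Ns.
have [i h] := hC (u s e) (d / C) (ltW dC) ms
  (le_trans (edge_norm_L2 (u s) e) (le_trans us (ltW Ns))).
by split=> //; apply: le_trans h _; rewrite mulrCA divff ?mulr1 ?lt0r_neq0.
Qed.

(** [h1_sup] bounds [w] by integrals that the [L^2] norms dominate. The common majorant [N] will be
    the [H^2] norm of an increment, which serves both for [m] and for its derivative. *)
Lemma h1_aeu (w : R -> netfun G) (g : R -> netfun G) (N : R -> \bar R) e :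
  (\forall s \near F, h1 (len e) (w s e) (g s e)) ->
  (\forall s \near F, (norm_L2 (w s) <= N s)%E) ->
  (\forall s \near F, (norm_L2 (g s) <= N s)%E) ->
  N s @[s --> F] --> 0%E ->
  forall d, 0 < d -> \forall s \near F, aeI (len e) (fun x => `|w s e x| <= d).
Proof.
have FF := within_PF; have FF' : Filter F by exact: FF.
move=> hw wN gN N0 d d0; have l0 := len_gt0 e.
(* The factor [len e] offsets the mean value in [h1_sup]. *)
have d1 : 0 < len e * (d / 2) by rewrite mulr_gt0// divr_gt0.
have d2 : 0 < d / 2 by rewrite divr_gt0.
have mw : \forall s \near F, measurable_fun `[0, len e] (w s e).
  by apply: filterS hw => s [].
have mg : \forall s \near F, measurable_fun `[0, len e] (g s e).
  by apply: filterS hw => s /h1_integ[_ /integ_measurable].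
have hW := L2_near_small FF' mw wN N0 d1.
have hG := L2_near_small FF' mg gN N0 d2.
apply: filterS3 hw hW hG => s h [_ h2] [_ h3].
apply: aeI_imp (h1_sup l0 h) => x _ /le_trans; apply.
have : (len e)^-1 * \int[mu]_(y in `[0, len e]) `|w s e y| <= d / 2.
  by rewrite ler_pdivrMl.
by move: h3; lra.
Qed.

(** The norm is that of the increment [D s], whose [dx] is a choice of its own: it agrees with
    [dx (m s) - dx (m t)] almost everywhere only. This suffices to make it weakly differentiable, so
    that [h1_aeu] applies to [D s] and to [dx (D s)]. *)
Lemma C0_H2_aeu (m : R -> netfun G) e : C0_in (@in_H2 R G) (@norm_H2 R G) T m ->
  aeu F (len e) (fun s => m s e) (m t e) /\
  aeu F (len e) (fun s => dx (m s) e) (dx (m t) e).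
Proof.
have FF := within_PF; have l0 := len_gt0 e.
move=> [hm cm].
pose D s : netfun G := fun e x => m s e x - m t e x.
have N0 : norm_H2 (D s) @[s --> F] --> 0%E := cm t tT.
have h1s s e' : s \in `[0, T] -> h1 (len e') (m s e') (dx (m s) e').
  by move=> /hm[h _]; exact: in_H1_h1.
have h2s s e' : s \in `[0, T] -> h1 (len e') (dx (m s) e') (dx (dx (m s)) e').
  by move=> /hm[_ h]; exact: in_H1_h1.
have hD s : s \in `[0, T] -> h1 (len e) (D s e) (dx (D s) e) /\
    aeI (len e) (fun x => dx (D s) e x = dx (m s) e x - dx (m t) e x).
  by move=> sT; apply: h1_wderiv => //; apply: h1B; exact: h1s.
have hDD s : s \in `[0, T] -> h1 (len e) (dx (D s) e) (dx (dx (D s)) e).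
  move=> sT; have [h h'] := hD s sT.
  have h2 := h1_ae (h1B (h2s s e sT) (h2s t e tT)) (integ_measurable (h1_integ h).2) h'.
  exact: (h1_wderiv l0 h2).1.
have bnd (f g' : R -> R) : h1 (len e) f g' -> exists2 M, 0 < M & aeI (len e) (fun x => `|f x| <= M).
  suff aux M : aeI (len e) (fun x => `|f x| <= M) ->
      exists2 M, 0 < M & aeI (len e) (fun x => `|f x| <= M).
    by move=> /(h1_sup l0); exact: aux.
  move=> h; exists (`|M| + 1); first by rewrite ltr_wpDl.
  by apply: aeI_imp h => x _ /le_trans; apply; rewrite (le_trans (ler_norm M))// lerDl.
have near1 (P : R -> Prop) : (forall s, s \in `[0, T] -> P s) -> \forall s \near F, P s.
  by move=> h; apply: filterS near_in => s; exact: h.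
split; split.
- by apply: near1 => s /(h1s s e)[].
- exact: (h1s t e tT).1.
- exact: bnd (h1s t e tT).
- apply: (@h1_aeu D (fun s => dx (D s)) (fun s => norm_H2 (D s))) => //.
  + by apply: near1 => s /hD[].
  + by apply: nearW => s; have [] := norm_H2_L2 (D s).
  + by apply: nearW => s; have [] := norm_H2_L2 (D s).
- by apply: near1 => s /(h2s s e)[].
- exact: (h2s t e tT).1.
- exact: bnd (h2s t e tT).
- move=> d d0.
  have h : \forall s \near F, aeI (len e) (fun x => `|dx (D s) e x| <= d).
    apply: (@h1_aeu (fun s => dx (D s)) (fun s => dx (dx (D s))) (fun s => norm_H2 (D s))) => //.
    + exact: near1 hDD.
    + by apply: nearW => s; have [] := norm_H2_L2 (D s).
    + by apply: nearW => s; have [] := norm_H2_L2 (D s).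
  have h' : \forall s \near F, aeI (len e) (fun x => dx (D s) e x = dx (m s) e x - dx (m t) e x).
    by apply: near1 => s /hD[].
  apply: filterS2 h h' => s a1 a2.
  by apply: aeI_imp (aeI_and a1 a2) => x _ [+ <-].
Qed.

End at_time.

Section time_derivative.
Variables (T t : R) (tT : 0 < t < T).

(** At an interior time the difference quotients of [C1_in] are two-sided. *)
Lemma within_dnbhs : within `[0, T] (dnbhs t) = t^'.
Proof.
have nT : \forall s \near t^', s \in `[0, T].
  apply: nbhs_dnbhs; have [t0 tT'] := andP tT.
  near=> s; rewrite in_itv/=; apply/andP; split; apply/ltW; near: s.
  - exact: lt_nbhsr.
  - exact: lt_nbhsl.
apply/seteqP; split => P /=; last by apply: filterS => s Ps _.
by apply: filterS2 nT => s sT; apply.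
Unshelve. all: by end_near. Qed.

Lemma C1_Loo_aeu (u du : R -> netfun G) e : C1_in (@in_Lp R G +oo) (@norm_Loo R G) T u du ->
  aeu t^' (len e) (fun s x => (u s e x - u t e x) * (s - t)^-1) (du t e).
Proof.
have tT' : t \in `[0, T] by have [t0 t1] := andP tT; rewrite in_itv/= !ltW.
move=> [[hu cu] [hdu cdu] h]; have := h t tT'; rewrite within_dnbhs => {}h.
have nT : \forall s \near t^', s \in `[0, T].
  by rewrite -within_dnbhs near_withinE; exact: nearW.
split.
- apply: filterS nT => s /hu us; apply: measurable_funM => //.
  by apply: measurable_funB; [exact: in_Lp_measurable us|exact: in_Lp_measurable (hu t tT')].
- exact: in_Lp_measurable (hdu t tT').
- exact: in_Loo_bounded (hdu t tT').
- move=> d d0.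
  have : \forall s \near t^',
      (norm_Loo (fun e x => (u s e x - u t e x) / (s - t) - du t e x)%R < d%:E)%E.
    exact: (cvge0_lt h d0).
  apply: filterS => s hs.
  apply: Lnormoo_ae; apply: le_trans (ltW hs).
  exact: edge_norm_Loo (fun e x => (u s e x - u t e x) / (s - t) - du t e x) e.
Qed.

Lemma C1_L2_L1c (u du : R -> netfun G) e : C1_in (@in_Lp R G 2%:E) (@norm_L2 R G) T u du ->
  L1c t^' (len e) (fun s x => (u s e x - u t e x) * (s - t)^-1) (du t e).
Proof.
have tT' : t \in `[0, T] by have [t0 t1] := andP tT; rewrite in_itv/= !ltW.
move=> [[hu cu] [hdu cdu] h]; have := h t tT'; rewrite within_dnbhs => {}h.
have nT : \forall s \near t^', s \in `[0, T].
  by rewrite -within_dnbhs near_withinE; exact: nearW.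
have is_ : \forall s \near t^', integ (len e) (fun x => (u s e x - u t e x) * (s - t)^-1).
  apply: filterS nT => s /hu us.
  have := integZ (s - t)^-1 (integB (in_L2_integ e us) (in_L2_integ e (hu t tT'))).
  by apply: eq_integ => x _; rewrite mulrC.
have i0 := in_L2_integ e (hdu t tT').
split=> //.
move=> d d0.
have ms : \forall s \near t^', measurable_fun `[0, len e]
    ((fun s e x => (u s e x - u t e x) / (s - t) - du t e x) s e).
  by apply: filterS is_ => s hs; exact: integ_measurable (integB hs i0).
have hN : \forall s \near t^', (norm_L2 (fun e x => (u s e x - u t e x) / (s - t) - du t e x)%R <=
   norm_L2 (fun e x => (u s e x - u t e x) / (s - t) - du t e x)%R)%E by exact: nearW.
have FF : Filter t^' by typeclasses eauto.
by apply: filterS (L2_near_small FF ms hN h d0) => s [].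
Qed.

End time_derivative.
End network_convergence.

(** * The energy identity in space *)

Section powers.
Context {R : realType}.
Implicit Types (l : R).

Lemma is_derive_inv (y : R) : 0 < y -> is_derive y 1 (@GRing.inv R) (- (y^-1) ^+ 2).
Proof.
move=> y0; have := is_deriveV (lt0r_neq0 y0) (is_derive_id y (1 : R)).
by rewrite /GRing.scale/= mulr1 exprVn.
Qed.

Lemma is_derive_powR (p y : R) : 0 < y ->
  is_derive y 1 (fun x => x `^ p) (p * y `^ (p - 1)).
Proof.
move=> y0; have yi : y \in `]0, +oo[ by rewrite in_itv/= y0.
split; first exact: derivable_powR.
by rewrite -derive1E powR_derive1.
Qed.

Lemma continuous_inv_pos (y : R) : 0 < y -> {for y, continuous (@GRing.inv R)}.
Proof. by move=> y0; apply: inv_continuous; exact: lt0r_neq0. Qed.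

Lemma continuous_inv2_pos (y : R) : 0 < y -> {for y, continuous (fun y : R => - (y^-1) ^+ 2)}.
Proof.
move=> y0; apply: cvgN; apply: (@continuous_comp _ _ _ (@GRing.inv R) (fun z : R => z ^+ 2)).
  exact: continuous_inv_pos.
exact: exprn_continuous.
Qed.

Lemma continuous_powR_pos (p y : R) : 0 < y -> {for y, continuous (fun x : R => x `^ p)}.
Proof.
move=> y0; apply/differentiable_continuous/derivable1_diffP.
by have [] := is_derive_powR p y0.
Qed.

Lemma continuous_dpowR_pos (p y : R) : 0 < y ->
  {for y, continuous (fun x : R => p * x `^ (p - 1))}.
Proof.
by move=> y0; apply: cvgM; [exact: cvg_cst|exact: continuous_powR_pos].
Qed.

Lemma measurable_inv : measurable_fun setT (@GRing.inv R).
Proof.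
(* The base of the real power is nonnegative after squaring, and at 0 both sides vanish by the
   convention on inverses. *)
have -> : @GRing.inv R = (fun x => x * (x ^+ 2) `^ (-1)).
  apply/funext => x; rewrite powR_inv1 ?sqr_ge0//.
  have [->|x0] := eqVneq x 0; first by rewrite invr0 mul0r.
  by field.
apply: measurable_funM => //.
apply: (measurableT_comp (measurable_powR (-1))).
exact: measurable_funX.
Qed.

Lemma within_comp_pos l (U phi : R -> R) : {within `[0, l], continuous U} ->
  (forall x, 0 <= x <= l -> 0 < U x) ->
  (forall y, 0 < y -> {for y, continuous phi}) ->
  {within `[0, l], continuous (phi \o U)}.
Proof.
move=> /within_itvP cU U0 cphi; apply/within_itvP => x e xl e0.
have /cvgrPdist_lt/(_ e e0)/nbhs_ballP[d /= d0 hd] := cphi _ (U0 x xl).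
have [d' d'0 hd'] := cU x d xl d0; exists d' => // y yl yx.
by rewrite distrC; apply: hd; rewrite /ball/= distrC; exact: hd'.
Qed.

Lemma acd_comp_pos l (U g phi phi' : R -> R) : acd l U g ->
  (forall x, 0 <= x <= l -> 0 < U x) ->
  (forall y : R, 0 < y -> is_derive y 1 phi (phi' y)) ->
  (forall y, 0 < y -> {for y, continuous phi'}) ->
  acd l (fun x => phi (U x)) (fun x => phi' (U x) * g x).
Proof.
move=> aU U0 dphi cphi'.
apply: (acd_comp aU); first by move=> x xl; apply: dphi; exact: U0.
by apply: within_comp_pos => //; exact: acd_within aU.
Qed.

(** [U] and [max r U] are continuous and agree almost everywhere, hence everywhere on [[0, l]]. *)
Lemma within_ge l (r : R) (U : R -> R) : 0 < l -> {within `[0, l], continuous U} ->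
  aeI l (fun x => r <= U x) -> forall x, 0 <= x <= l -> r <= U x.
Proof.
move=> l0 cU rU x xl.
have cM : {within `[0, l], continuous (fun x => Num.max r (U x))}.
  move/within_itvP : cU => cU; apply/within_itvP => y e yl e0.
  have [d d0 hd] := cU y e yl e0; exists d => // z zl zy.
  apply: le_lt_trans (hd z zl zy).
  rewrite !maxEle; case: ifPn => h1; case: ifPn => h2; rewrite ?subrr ?normr0//.
  - rewrite -ltNge in h2; rewrite [leRHS]ger0_norm ?ger0_norm; lra.
  - rewrite -ltNge in h1; rewrite [leRHS]ler0_norm ?ler0_norm; lra.
have -> : U x = Num.max r (U x).
  apply: (within_ae_eq l0 cU cM) xl; apply: aeI_imp rU => y _ h.
  by rewrite max_r.
by rewrite le_max lexx.
Qed.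

End powers.

Section edge_identity.
Context {R : realType}.
Notation mu := (@lebesgue_measure R).

(* The time derivative of the energy density, [drho] and [dm] being those of
   [rho] and [m]. *)
Definition edot (c gamma : R) (rho m drho dm : R -> R) (x : R) : R :=
  (m x + m x) * 2^-1 * (rho x)^-1 * dm x +
  (m x ^+ 2 / 2 * (- (rho x)^-1 ^+ 2 * drho x) +
   c / (gamma - 1) * (gamma * rho x `^ (gamma - 1) * drho x)).

(* The energy flux [m (h - a w)]. *)
Definition eflux (a c gamma : R) (Rho Mu Nu : R -> R) (x : R) : R :=
  Mu x * (Mu x ^+ 2 / (2 * Rho x ^+ 2) + c / (gamma - 1) * (gamma * Rho x `^ (gamma - 1))
    - a / Rho x ^+ 2 * Nu x).

(** After multiplication by [m/rho], viscosity contributes [a m w' = (a m w)' - a m'^2/rho^2] with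
    [w = m'/rho^2], and friction [- b |m|^3/rho^2]. Convection and pressure, together with the term
    in [drho = - m'], make up [- (m h)']. Integration leaves the flux at the two ends. *)
Lemma edge_energy (l a b c gamma r : R) (rho m n drho dm Rho Mu Nu rho' nu' : R -> R) :
  0 < l -> 1 < gamma -> 0 < r ->
  measurable_fun `[0, l] rho -> measurable_fun `[0, l] m ->
  measurable_fun `[0, l] n -> measurable_fun `[0, l] drho ->
  measurable_fun `[0, l] dm ->
  acd l Rho rho' -> acd l Mu Nu -> acd l Nu nu' ->
  aeI l (fun x => rho x = Rho x) -> aeI l (fun x => m x = Mu x) ->
  aeI l (fun x => n x = Nu x) -> (forall x, 0 <= x <= l -> r <= Rho x) ->
  aeI l (fun x => drho x + n x = 0) ->
  aeI l (fun x => dm x + wderiv l (fun x => m x ^+ 2 / rho x + c * rho x `^ gamma) x =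
    a * rho x * wderiv l (fun x => 1 / rho x ^+ 2 * n x) x -
    b * (`|m x| * m x / rho x)) ->
  \int[mu]_(x in `[0, l]) edot c gamma rho m drho dm x =
  - (eflux a c gamma Rho Mu Nu l - eflux a c gamma Rho Mu Nu 0) -
  \int[mu]_(x in `[0, l]) (a * (`|n x| ^+ 2 / `|rho x| ^+ 2) +
    b * (`|m x| ^+ 3 / `|rho x| ^+ 2)).
Proof.
move=> l0 g1 r0 mrho mm mn mdrho mdm aR aM aN rR mM nN Rr E1 E2.
have R0 x : 0 <= x <= l -> 0 < Rho x by move=> /Rr; lra.
(* These are, in order, representatives of [1/rho], [rho^gamma], [rho^(gamma-1)], [1/rho^2], [m^2],
   the momentum flux, [w], [h] and the energy flux [m (h - a w)]. *)
have aI := acd_comp_pos aR R0 is_derive_inv continuous_inv2_pos.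
have aG := acd_comp_pos aR R0 (@is_derive_powR R gamma) (@continuous_dpowR_pos R gamma).
have aG1 := acd_comp_pos aR R0 (@is_derive_powR R (gamma - 1))
  (@continuous_dpowR_pos R (gamma - 1)).
have aI2 := acdM aI aI.
have aM2 := acdM aM aM.
have aQ := acd_lin 1 c (acdM aM2 aI) aG.
have aW := acdM aI2 aN.
have aH := acd_lin (1/2) (c * gamma / (gamma - 1)) (acdM aM2 aI2) aG1.
have aS := acdM aM (acd_lin 1 (- a) aH aW).
have mV : measurable_fun `[0, l] (fun x => (rho x)^-1).
  exact: (measurableT_comp measurable_inv).
have mP p : measurable_fun `[0, l] (fun x => rho x `^ p).
  exact: (measurableT_comp (measurable_powR p)).
have mQ : measurable_fun `[0, l] (fun x => m x ^+ 2 / rho x + c * rho x `^ gamma).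
  apply: measurable_funD; apply: measurable_funM => //; exact: measurable_funX.
have mW : measurable_fun `[0, l] (fun x => 1 / rho x ^+ 2 * n x).
  apply: measurable_funM => //; apply: measurable_funM => //.
  by apply: (measurableT_comp measurable_inv); exact: measurable_funX.
have WQ := acd_wderiv l0 aQ mQ.
have WW := acd_wderiv l0 aW mW.
have {}WQ := WQ (ltac:(by apply: aeI_imp (aeI_and rR mM) => x _ [-> ->]; rewrite mul1r expr2)).
have {}WW := WW (ltac:(by apply: aeI_imp (aeI_and rR nN) => x _ [-> ->];
  rewrite div1r expr2 invfM)).
have iS := aS.1.
pose diss x := a * (`|n x| ^+ 2 / `|rho x| ^+ 2) + b * (`|m x| ^+ 3 / `|rho x| ^+ 2).
have mdiss : measurable_fun `[0, l] diss.
  have mabs (f : R -> R) (k : nat) : measurable_fun `[0, l] f ->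
      measurable_fun `[0, l] (fun x => `|f x| ^+ k).
    by move=> mf; apply: measurable_funX; exact: measurableT_comp.
  apply: measurable_funD; apply: measurable_funM => //; apply: measurable_funM.
  - exact: mabs.
  - by apply: (measurableT_comp measurable_inv); exact: mabs.
  - exact: mabs.
  - by apply: (measurableT_comp measurable_inv); exact: mabs.
have cMN := acd_within aM; have cN := acd_within aN.
have cI := acd_within aI.
have idiss : integ l diss.
  have i1 := integ_contM cN (integ_contM cN (integ_contM cI (acd_integ aI))).
  have i2 := integ_contM cMN (integ_contM cMN (integ_norm (integ_contM cMN
    (integ_contM cI (acd_integ aI))))).
  apply: integ_ae (integD (integZ a i1) (integZ b i2)) mdiss _.
  apply: aeI_imp (aeI_and (aeI_and rR mM) nN) => x xl [[h1 h2] h3].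
  rewrite /diss h1 h2 h3 (exprS _ 2) !real_normK ?num_real// !normrM.
  rewrite !(gtr0_norm (_ : 0 < (Rho x)^-1)) ?invr_gt0 ?R0//.
  by field; rewrite lt0r_neq0// R0.
move: aS; set dS := (X in acd _ _ X) => aS.
have -> : \int[mu]_(x in `[0, l]) edot c gamma rho m drho dm x =
  \int[mu]_(x in `[0, l]) (- dS x - diss x).
  apply: eq_ae_int.
  - apply: measurable_funD; first apply: measurable_funM => //.
      apply: measurable_funM => //; apply: measurable_funM => //; exact: measurable_funD.
    apply: measurable_funD; apply: measurable_funM => //.
    + by apply: measurable_funM => //; exact: measurable_funX.
    + apply: measurable_funM => //; apply: measurableT_comp => //; exact: measurable_funX.
    + by apply: measurable_funM => //; apply: measurable_funM.
  - by apply: integ_measurable; apply: integB => //; apply: integN; case: aS.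
  - apply: aeI_imp (aeI_and (aeI_and (aeI_and rR mM) (aeI_and nN E1)) (aeI_and E2 (aeI_and WQ WW))).
    move=> x xl [[[rx mx] [nx e1]] [e2 [e3 e4]]].
    have Rx := R0 x xl.
    have dmE : dm x = a * rho x * ((- (Rho x)^-1 ^+ 2 * rho' x / Rho x +
      (Rho x)^-1 * (- (Rho x)^-1 ^+ 2 * rho' x)) * Nu x + (Rho x)^-1 / Rho x * nu' x)
      - b * (`|m x| * m x / rho x) - (1 * ((Nu x * Mu x + Mu x * Nu x) / Rho x +
      Mu x * Mu x * (- (Rho x)^-1 ^+ 2 * rho' x)) + c * (gamma * Rho x `^ (gamma - 1) * rho' x)).
      by move: e2; rewrite e3 e4 => <-; ring.
    have drE : drho x = - Nu x by move: e1; rewrite nx; lra.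
    (* All powers become multiples of [Rho x] to the [gamma - 2], so that [field] can see the
       identity [rho P'' = p']. *)
    have pE : Rho x `^ (gamma - 1) = Rho x * Rho x `^ (gamma - 1 - 1).
      by rewrite mulr_powRB1 ?ltW//; lra.
    rewrite /edot /diss /dS dmE drE rx mx nx (exprS `|Mu x| 2) !real_normK ?num_real// pE.
    field; rewrite !lt0r_neq0//; lra.
have [iS' _] := aS.
rewrite RintegralB//; last exact: integN.
congr (_ - _).
have -> : \int[mu]_(x in `[0, l]) - dS x = - \int[mu]_(x in `[0, l]) dS x.
  by under eq_Rintegral do rewrite -mulN1r; rewrite RintegralZl// mulN1r.
rewrite (acd_FTC (ltW l0) aS) /eflux.
have fE y : 0 <= y <= l -> Mu y * (Mu y ^+ 2 / (2 * Rho y ^+ 2) +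
   c / (gamma - 1) * (gamma * Rho y `^ (gamma - 1)) - a / Rho y ^+ 2 * Nu y) =
   Mu y * (1 * (1 / 2 * (Mu y * Mu y * ((Rho y)^-1 / Rho y)) +
      c * gamma / (gamma - 1) * Rho y `^ (gamma - 1)) +
      - a * ((Rho y)^-1 / Rho y * Nu y)).
  move=> yl; have Ry := R0 y yl.
  by field; rewrite !lt0r_neq0//; lra.
by rewrite !fE// ?lexx ?ltW.
Qed.

End edge_identity.

(** * Vertex conditions and summation over the edges *)

Section network_balance.
Context {R : realType} {G : network R}.
Notation mu := (@lebesgue_measure R).
Implicit Types (u : netfun G) (e : edge G) (v : vertex G).

Lemma source_neq_target e : source e != target e.
Proof.
apply/negP => /eqP st; have := edge_loopless (source e).
rewrite -{2}[source e]/((val e).1) => /negP; apply.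
have -> : (source e, source e) = val e by rewrite {2}st /source /target; case: (val e).
exact: valP.
Qed.

(** A discrete divergence theorem: after exchanging the sums, each edge is met exactly at its two
    ends, distinct for lack of loops, with normals -1 and 1. *)
Lemma sum_normal (X : edge G -> vertex G -> R) :
  \sum_e (X e (target e) - X e (source e)) =
  \sum_v \sum_(e in incident v) X e v * normal e v.
Proof.
rewrite (exchange_big_dep xpredT)//=; apply: eq_bigr => e _.
have st := source_neq_target e.
rewrite (bigD1 (source e))/= ?inE ?eqxx//.
rewrite (bigD1 (target e))/= ?inE ?eqxx ?orbT 1?eq_sym//.
rewrite big1; last first.
  by move=> v; rewrite inE => /andP[/andP[]] /orP[]/eqP ->; rewrite eqxx.
rewrite /normal eqxx [target e == source e]eq_sym (negbTE st) eqxx.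
by rewrite mulrN1 mulr1 addr0 addrC.
Qed.

Lemma trace_source u e U : {within `[0, len e], continuous U} ->
  aeI (len e) (fun x => u e x = U x) -> trace u e (source e) = U 0.
Proof.
move=> cU uU; rewrite /trace /Defs.coord eqxx.
by apply: (continuous_repE (len_gt0 e) cU uU); rewrite lexx ltW// len_gt0.
Qed.

Lemma trace_target u e U : {within `[0, len e], continuous U} ->
  aeI (len e) (fun x => u e x = U x) -> trace u e (target e) = U (len e).
Proof.
move=> cU uU; rewrite /trace /Defs.coord eq_sym (negbTE (source_neq_target e)).
by apply: (continuous_repE (len_gt0 e) cU uU); rewrite lexx ltW// len_gt0.
Qed.

Lemma derive1_potential (c : edge G -> R) gamma e (r : R) : 0 < r ->
  derive1 (potential c gamma e) r = c e / (gamma - 1) * (gamma * r `^ (gamma - 1)).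
Proof.
move=> r0; rewrite derive1E.
by have [_] := is_deriveZ (c e / (gamma - 1)) (is_derive_powR gamma r0).
Qed.

Variables (a b c : edge G -> R) (gamma : R) (rho m drho dm : netfun G).
Hypotheses (g1 : 1 < gamma) (hrho : in_H1plus rho) (hm : in_H2 m).
Hypotheses (hdrho : in_Lp +oo%E drho) (hdm : in_Lp 2%:E dm).
Hypothesis feq : flow_equations a b c gamma rho m drho dm.

Lemma edge_reps e : exists r Rho Mu Nu rho' nu', [/\ 0 < r,
  [/\ acd (len e) Rho rho', acd (len e) Mu Nu & acd (len e) Nu nu'],
  [/\ aeI (len e) (fun x => rho e x = Rho x), aeI (len e) (fun x => m e x = Mu x) &
      aeI (len e) (fun x => dx m e x = Nu x)] &
  forall x, 0 <= x <= len e -> r <= Rho x].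
Proof.
have [hr [r r0 rr]] := hrho; have [hm1 hm2] := hm.
have [mr [Rho aR rR]] := in_H1_h1 e hr.
have [mm [Mu aM mM]] := in_H1_h1 e hm1.
have [mn [Nu aN nN]] := in_H1_h1 e hm2.
exists r, Rho, Mu, Nu, (dx rho e), (dx (dx m) e).
(* The derivative of [Mu] is taken to be the continuous [Nu] itself, so that one function is both
   the derivative inside the edge and the source of the traces. *)
have aM' : acd (len e) Mu Nu.
  by apply: acd_ae aM (integ_measurable (acd_integ aN)) nN.
split => //.
apply: (within_ge (len_gt0 e) (acd_within aR)).
have /aeIP rr' := rr e.
by apply: aeI_imp (aeI_and rR rr') => x _ [->].
Qed.

Lemma mass_rate : \sum_e \int[mu]_(x in `[0, len e]) drho e x = 0.
Proof.
have edgeE e : \int[mu]_(x in `[0, len e]) drho e x =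
    - (trace m e (target e) - trace m e (source e)).
  have [r [Rho [Mu [Nu [rho' [nu' [r0 [aR aM aN] [rR mM nN] Rr]]]]]]] := edge_reps e.
  rewrite (trace_target (acd_within aM) mM) (trace_source (acd_within aM) mM).
  rewrite -(acd_FTC (ltW (len_gt0 e)) aM).
  have iN := acd_integ aN.
  have -> : - (\int[mu]_(x in `[0, len e]) Nu x) = \int[mu]_(x in `[0, len e]) (-1 * Nu x).
    by rewrite RintegralZl// mulN1r.
  apply: eq_ae_int; first exact: in_Lp_measurable hdrho.
    exact: integ_measurable (integZ (-1) iN).
  have /aeIP E := mass_balance feq e.
  by apply: aeI_imp (aeI_and nN E) => x _ [->]; lra.
under eq_bigr do rewrite edgeE.
rewrite sumrN (sum_normal (trace m)) big1 ?oppr0// => v _.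
have [iv|niv] := boolP (inner v); first exact: junction_mass feq v iv.
by rewrite big1// => e; exact: (boundary_flux feq niv).
Qed.

Lemma energy_rate : \sum_e \int[mu]_(x in `[0, len e])
    edot (c e) gamma (rho e) (m e) (drho e) (dm e) x = - dissipation a b rho m.
Proof.
pose X e v := trace m e v * (trace m e v ^+ 2 / (2 * trace rho e v ^+ 2) +
  c e / (gamma - 1) * (gamma * trace rho e v `^ (gamma - 1))
  - a e / trace rho e v ^+ 2 * trace (dx m) e v).
have trho e v : e \in incident v -> 0 < trace rho e v.
  have [r [Rho [Mu [Nu [rho' [nu' [r0 [aR aM aN] [rR mM nN] Rr]]]]]]] := edge_reps e.
  rewrite inE => /orP[]/eqP <-.
    by rewrite (trace_source (acd_within aR) rR) (lt_le_trans r0)// Rr// lexx ltW// len_gt0.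
  by rewrite (trace_target (acd_within aR) rR) (lt_le_trans r0)// Rr// lexx ltW// len_gt0.
have edgeE e : \int[mu]_(x in `[0, len e]) edot (c e) gamma (rho e) (m e) (drho e) (dm e) x =
    - (X e (target e) - X e (source e)) -
    \int[mu]_(x in `[0, len e]) (a e * (`|dx m e x| ^+ 2 / `|rho e x| ^+ 2) +
      b e * (`|m e x| ^+ 3 / `|rho e x| ^+ 2)).
  have [r [Rho [Mu [Nu [rho' [nu' [r0 [aR aM aN] [rR mM nN] Rr]]]]]]] := edge_reps e.
  have /aeIP E1 := mass_balance feq e.
  have /aeIP E2 := momentum_balance feq e.
  have [hr _] := hrho; have [hm1 hm2] := hm.
  have [mr _] := in_H1_h1 e hr; have [mm _] := in_H1_h1 e hm1; have [mn _] := in_H1_h1 e hm2.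
  rewrite (edge_energy (len_gt0 e) g1 r0 mr mm mn (in_Lp_measurable hdrho)
    (in_Lp_measurable hdm) aR aM aN rR mM nN Rr E1 E2).
  rewrite /X !(trace_target (acd_within aM) mM) !(trace_source (acd_within aM) mM).
  rewrite !(trace_target (acd_within aR) rR) !(trace_source (acd_within aR) rR).
  by rewrite !(trace_target (acd_within aN) nN) !(trace_source (acd_within aN) nN).
under eq_bigr do rewrite edgeE.
rewrite big_split/= [X in _ + X]sumrN -[RHS]add0r; congr (_ + _).
rewrite sumrN (sum_normal X) big1 ?oppr0// => v _.
have [iv|niv] := boolP (inner v); last first.
  rewrite big1// => e ev; rewrite /X mulrAC.
  by rewrite (boundary_flux feq niv)// mul0r.
have [h hE] := junction_energy feq iv.
rewrite (eq_bigr (fun e => trace m e v * normal e v * h)).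
  by rewrite -mulr_suml (junction_mass feq iv) mul0r.
move=> e ev; rewrite /X; have := hE e ev; rewrite (derive1_potential _ _ _ (trho e v ev)) => ->.
by rewrite addrK mulrAC.
Qed.

End network_balance.

(** * The balance laws in time *)

Section balance_law.
Context {R : realType}.
Notation mu := (@lebesgue_measure R).

(** Shared by the mass, with [D = 0], and the energy. Differentiability is asked at interior times,
    where the quotients are two-sided; continuity covers the end points. *)
Lemma ftc_balance (T : R) (E D : R -> R) :
  (forall t, t \in `[0, T] -> E s @[s --> within `[0, T] (nbhs t)] --> E t) ->
  (forall t, t \in `[0, T] -> D s @[s --> within `[0, T] (nbhs t)] --> D t) ->
  (forall t, 0 < t < T -> (E s - E t) * (s - t)^-1 @[s --> t^'] --> - D t) ->
  forall t, 0 <= t <= T -> E t + \int[mu]_(s in `[0, t]) D s = E 0.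
Proof.
move=> cE cD dE t /andP[]; rewrite le_eqVlt => /predU1P[<- _|t0 tT].
  by rewrite set_itv1 Rintegral_set1 addr0.
have wc (f : R -> R) : (forall t, t \in `[0, T] -> f s @[s --> within `[0, T] (nbhs t)] --> f t) ->
    {within `[0, t], continuous f}.
  move=> cf; apply: (@continuous_subspaceW _ _ _ `[0, T]).
    by move=> x /=; rewrite !in_itv/= => /andP[-> xt]; exact: le_trans xt tT.
  by apply/subspace_continuousP => x xT; exact: cf.
have der s : 0 < s < t -> is_derive s 1 E (- D s).
  move=> /andP[s0 st]; apply/is_derive1P => e e0.
  have := dE s; rewrite s0 (lt_le_trans st tT) => /(_ isT) /cvgrPdist_le/(_ e e0).
  rewrite near_withinE => /nbhs_ballP[d /= d0 hd]; exists d => // y yd.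
  have [->|ys] := eqVneq y s; first by rewrite !subrr mulr0 subrr normr0 mulr0.
  have ys0 : y - s != 0 by rewrite subr_eq0.
  have := hd y; rewrite /ball/= distrC => /(_ yd ys).
  have -> : E y - E s - - D s * (y - s) = - ((- D s - (E y - E s) * (y - s)^-1) * (y - s)).
    by field.
  by rewrite normrN normrM => h; rewrite ler_wpM2r.
have -> : \int[mu]_(s in `[0, t]) D s = E 0 - E t; last by lra.
have cD' := wc D cD; have cE' := wc E cE.
have iD : integ t D.
  by apply: continuous_compact_integrable => //; exact: segment_compact.
have -> : \int[mu]_(s in `[0, t]) D s = - (\int[mu]_(s in `[0, t]) (-1 * D s)).
  by rewrite RintegralZl// mulN1r opprK.
rewrite /Rintegral (@continuous_FTC2 _ _ E)//=; first by lra.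
- move/within_itvP : cD' => cD'; apply/within_itvP => x e xt e0.
  have [d d0 hd] := cD' x e xt e0; exists d => // y yt yx.
  by rewrite -mulrBr normrM normrN1 mul1r; exact: hd.
- split.
  + by move=> s; rewrite in_itv/= => /der[].
  + by have /(continuous_within_itvP _ t0)[] := cE'.
  + by have /(continuous_within_itvP _ t0)[] := cE'.
- by move=> s; rewrite in_itv/= => /der ds; rewrite derive1E derive_val mulN1r.
Qed.

Lemma cvg_finsum (I : finType) (F : set_system R) {FF : Filter F} (f : I -> R -> R) (l : I -> R) :
  (forall i, f i s @[s --> F] --> l i) -> \sum_i f i s @[s --> F] --> \sum_i l i.
Proof.
move=> fl; elim: (index_enum I) => [|i r IH].
  by rewrite big_nil; under eq_fun do rewrite big_nil; exact: cvg_cst.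
rewrite big_cons; under eq_fun do rewrite big_cons.
exact: cvgD.
Qed.

End balance_law.

Section aeu_more.
Context {R : realType} {F : set_system R} {FF : ProperFilter F}.

Lemma eq_aeu l (f g : R -> R -> R) (f0 g0 : R -> R) :
  (forall s x, f s x = g s x) -> (forall x, f0 x = g0 x) -> aeu F l f f0 -> aeu F l g g0.
Proof.
move=> fg fg0; have -> : f = g by apply/funext => s; apply/funext => x; exact: fg.
by have -> : f0 = g0 by apply/funext => x; exact: fg0.
Qed.

Lemma aeu_norm l (f : R -> R -> R) f0 : aeu F l f f0 ->
  aeu F l (fun s x => `|f s x|) (fun x => `|f0 x|).
Proof.
move=> [nf mf [M M0 bf] cf]; split.
- by apply: filterS nf => s ms; exact: measurableT_comp.
- exact: measurableT_comp.
- by exists M => //; apply: aeI_imp bf => x _; rewrite normr_id.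
- move=> e e0; apply: filterS (cf e e0) => s; apply: aeI_imp => x _.
  exact/le_trans/ler_dist_dist.
Qed.

Lemma aeu_filter (F' : set_system R) l (f : R -> R -> R) f0 :
  (forall P : set R, F P -> F' P) -> aeu F l f f0 -> aeu F' l f f0.
Proof. by move=> FF' [nf mf bf cf]; split => // [|e e0]; apply: FF' => //; exact: cf. Qed.

End aeu_more.

(** * Energy and dissipation densities along a filter of times *)

Section densities.
Context {R : realType} {F : set_system R} {FF : ProperFilter F}.
Variables (l a b c gamma r : R) (rho m n : R -> R -> R) (rhot mt nt : R -> R).
Hypotheses (r0 : 0 < r) (arho : aeu F l rho rhot) (am : aeu F l m mt) (an : aeu F l n nt).
Hypothesis rr : aeI l (fun x => r <= rhot x).

Lemma aeu_inv : aeu F l (fun s x => (rho s x)^-1) (fun x => (rhot x)^-1).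
Proof. exact: aeu_comp r0 measurable_inv continuous_inv_pos arho rr. Qed.

Lemma aeu_powR p : aeu F l (fun s x => rho s x `^ p) (fun x => rhot x `^ p).
Proof.
exact: aeu_comp r0 (measurable_powR p) (@continuous_powR_pos R p) arho rr.
Qed.

Lemma aeu_energy : aeu F l
  (fun s x => m s x ^+ 2 / (2 * rho s x) + c / (gamma - 1) * rho s x `^ gamma)
  (fun x => mt x ^+ 2 / (2 * rhot x) + c / (gamma - 1) * rhot x `^ gamma).
Proof.
pose proof (aeuD (aeuM (aeuM am am) (aeuM (aeu_scalar l 2^-1) aeu_inv))
  (aeuM (aeu_scalar l (c / (gamma - 1))) (aeu_powR gamma))) as h.
by apply: eq_aeu h => [s|] x /=; rewrite expr2 invfM.
Qed.

Lemma aeu_dissipation : aeu F l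
  (fun s x => a * (`|n s x| ^+ 2 / `|rho s x| ^+ 2) + b * (`|m s x| ^+ 3 / `|rho s x| ^+ 2))
  (fun x => a * (`|nt x| ^+ 2 / `|rhot x| ^+ 2) + b * (`|mt x| ^+ 3 / `|rhot x| ^+ 2)).
Proof.
pose proof (aeu_norm am) as am'; pose proof (aeu_norm an) as an'.
pose proof (aeu_norm aeu_inv) as ai'.
pose proof (aeuM ai' ai') as i2.
pose proof (aeuD (aeuM (aeu_scalar l a) (aeuM (aeuM an' an') i2))
  (aeuM (aeu_scalar l b) (aeuM (aeuM am' (aeuM am' am')) i2))) as h.
by apply: eq_aeu h => [s|] x /=; rewrite !normfV -!invfM -!expr2 -exprS.
Qed.

End densities.

Section energy_derivative.
Context {R : realType}.
Notation mu := (@lebesgue_measure R).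
Variables (l c gamma r t : R) (rho m : R -> R -> R) (drho dm : R -> R).
Hypotheses (l0 : 0 < l) (r0 : 0 < r) (arho : aeu t^' l rho (rho t)) (am : aeu t^' l m (m t)).
Hypothesis rr : aeI l (fun x => r <= rho t x).
Hypothesis qrho : aeu t^' l (fun s x => (rho s x - rho t x) * (s - t)^-1) drho.
Hypothesis qm : L1c t^' l (fun s x => (m s x - m t x) * (s - t)^-1) dm.

Let ed s x := m s x ^+ 2 / (2 * rho s x) + c / (gamma - 1) * rho s x `^ gamma.

(** The increment of [m^2/(2 rho)] is written as [(m s + m t)/2/rho s * (m s - m t)] plus
    [m t^2/2 * (1/rho s - 1/rho t)]. The quotient of [m] thus occurs once, against a uniformly
    convergent factor, while those of [1/rho] and [rho^gamma] converge uniformly by [aeu_chain].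
    This also explains the shape of [edot]. *)
Lemma edge_energy_derivative :
  (\int[mu]_(x in `[0, l]) ed s x - \int[mu]_(x in `[0, l]) ed t x) * (s - t)^-1 @[s --> t^']
  --> \int[mu]_(x in `[0, l]) edot c gamma (rho t) (m t) drho dm x.
Proof.
have FF : ProperFilter t^' by typeclasses eauto.
have aed : aeu t^' l ed (ed t) by exact: (@aeu_energy _ _ _ _ c gamma _ _ _ _ _ r0 arho am rr).
have [ned ied _] : L1c t^' l ed (ed t) by exact: aeu_L1c.
have mtc : aeu t^' l (fun _ => m t) (m t).
  have [M M0 hM] := aeu_bounded am.
  exact: aeu_cst (aeu_meas am) hM.
pose proof (L1cM (aeuM (aeuM (aeuD am mtc) (aeu_scalar l 2^-1)) (aeu_inv r0 arho rr)) qm) as h1.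
have mI2 : measurable_fun setT (fun y : R => - y^-1 ^+ 2).
  by apply: measurableT_comp => //; apply: measurable_funX; exact: measurable_inv.
pose proof (aeuM (aeuM (aeuM mtc mtc) (aeu_scalar l 2^-1))
  (aeu_chain r0 measurable_inv mI2 is_derive_inv continuous_inv2_pos arho rr qrho)) as h2.
have mP : measurable_fun setT (fun y : R => gamma * y `^ (gamma - 1)).
  by apply: measurable_funM => //; exact: measurable_powR.
pose proof (aeuM (aeu_scalar l (c / (gamma - 1)))
  (aeu_chain r0 (measurable_powR gamma) mP (@is_derive_powR R gamma)
     (@continuous_dpowR_pos R gamma) arho rr qrho)) as h3.
pose proof (L1c_int (L1cD h1 (aeu_L1c l0 (aeuD h2 h3)))) as h.
have eD : \int[mu]_(x in `[0, l]) edot c gamma (rho t) (m t) drho dm x =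
  \int[mu]_(x in `[0, l]) ((m t x + m t x) / 2 / rho t x * dm x +
    (m t x * m t x / 2 * (- (rho t x)^-1 ^+ 2 * drho x) +
     c / (gamma - 1) * (gamma * rho t x `^ (gamma - 1) * drho x))).
  by apply: eq_Rintegral => x _; rewrite /edot expr2.
rewrite eD; apply: cvg_trans h; apply: near_eq_cvg; near=> s.
have eds : integ l (ed s) by near: s.
rewrite -RintegralB// -RintegralZr//; last exact: integB.
apply: eq_Rintegral => x _; rewrite /ed !invfM; ring.
Unshelve. all: by end_near. Qed.

End energy_derivative.

Lemma within_sub_dnbhs (R : realType) (T t : R) : 0 < t < T ->
  forall P : set R, within `[0, T] (nbhs t) P -> t^' P.
Proof.
move=> tT P hP; rewrite -(within_dnbhs tT); exact: nbhs_dnbhs hP.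
Qed.

(** Initial values are prescribed up to null sets, so the energy has to be insensitive to them. *)
Lemma energy_ext (R : realType) (G : network R) (c : edge G -> R) (gamma : R)
    (rho m rho' m' : netfun G) :
  in_H1 rho -> in_H1 m -> in_H1 rho' -> in_H1 m' ->
  net_ae (fun e x => rho e x = rho' e x) -> net_ae (fun e x => m e x = m' e x) ->
  energy c gamma rho m = energy c gamma rho' m'.
Proof.
move=> h1 h2 h3 h4 rr mm; apply: eq_bigr => e _.
have meas (u v : netfun G) : in_H1 u -> in_H1 v -> measurable_fun `[0, len e]
    (fun x => v e x ^+ 2 / (2 * u e x) + potential c gamma e (u e x)).
  move=> hu hv; have [mu_ _] := in_H1_h1 e hu; have [mv _] := in_H1_h1 e hv.
  apply: measurable_funD; apply: measurable_funM => //.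
  - exact: measurable_funX.
  - by apply: (measurableT_comp measurable_inv); exact: measurable_funM.
  - exact: (measurableT_comp (measurable_powR gamma)).
apply: eq_ae_int; [exact: meas|exact: meas|].
have /aeIP rr' := rr e; have /aeIP mm' := mm e.
by apply: aeI_imp (aeI_and rr' mm') => x _ [-> ->].
Qed.

(** * Continuity and differentiability in time for a smooth solution *)

Section smooth_solutions.
Context {R : realType} {G : network R}.
Notation mu := (@lebesgue_measure R).
Variables (a b c : edge G -> R) (gamma T : R) (rho m drho dm : R -> netfun G).
Hypothesis g1 : 1 < gamma.
Hypotheses (c1rho : C1_in (@in_Lp R G +oo) (@norm_Loo R G) T rho drho)
  (c1m : C1_in (@in_Lp R G 2%:E) (@norm_L2 R G) T m dm)
  (c0rho : C0_in (@in_H1plus R G) (@norm_H1 R G) T rho)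
  (c0m : C0_in (@in_H2 R G) (@norm_H2 R G) T m).
Hypothesis feq : forall t, 0 < t <= T ->
  flow_equations a b c gamma (rho t) (m t) (drho t) (dm t).

Lemma solution_aeu t e : t \in `[0, T] -> let F := within `[0, T] (nbhs t) in
  [/\ aeu F (len e) (fun s => rho s e) (rho t e),
      aeu F (len e) (fun s => m s e) (m t e),
      aeu F (len e) (fun s => dx (m s) e) (dx (m t) e) &
      exists2 r, 0 < r & aeI (len e) (fun x => r <= rho t e x)].
Proof.
move=> tT /=; have [am an] := C0_H2_aeu tT e c0m.
split => //; first by apply: C0_Loo_aeu => //; case: c1rho.
have [_ [r r0 rr]] := c0rho.1 t tT; exists r => //.
by have /aeIP := rr e.
Qed.

Lemma mass_cvg t : t \in `[0, T] ->
  net_integral (rho s) @[s --> within `[0, T] (nbhs t)] --> net_integral (rho t).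
Proof.
move=> tT; have FF := within_PF tT.
apply: cvg_finsum => e; have [ar _ _ _] := solution_aeu e tT.
exact: L1c_int (aeu_L1c (len_gt0 e) ar).
Qed.

Lemma energy_cvg t : t \in `[0, T] ->
  energy c gamma (rho s) (m s) @[s --> within `[0, T] (nbhs t)] -->
  energy c gamma (rho t) (m t).
Proof.
move=> tT; have FF := within_PF tT.
apply: cvg_finsum => e; have [ar am _ [r r0 rr]] := solution_aeu e tT.
exact: L1c_int (aeu_L1c (len_gt0 e) (aeu_energy _ gamma r0 ar am rr)).
Qed.

Lemma dissipation_cvg t : t \in `[0, T] ->
  dissipation a b (rho s) (m s) @[s --> within `[0, T] (nbhs t)] -->
  dissipation a b (rho t) (m t).
Proof.
move=> tT; have FF := within_PF tT.
apply: cvg_finsum => e; have [ar am an [r r0 rr]] := solution_aeu e tT.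
exact: L1c_int (aeu_L1c (len_gt0 e) (aeu_dissipation _ _ r0 ar am an rr)).
Qed.

(** The limit is written [- (0 : R)] to match [- D t] in [ftc_balance] for [D = 0]. *)
Lemma mass_derivative t : 0 < t < T ->
  (net_integral (rho s) - net_integral (rho t)) * (s - t)^-1 @[s --> t^'] --> - (0 : R).
Proof.
move=> tT; have [t0 tltT] := andP tT.
have tT' : t \in `[0, T] by rewrite in_itv/= !ltW.
have ftT : 0 < t <= T by rewrite t0 ltW.
have [_ [hdrho _] _] := c1rho.
have <- : \sum_e \int[mu]_(x in `[0, len e]) drho t e x = - (0 : R).
  by rewrite oppr0; exact: mass_rate (c0rho.1 t tT') (c0m.1 t tT') (hdrho t tT') (feq ftT).
have FF : ProperFilter t^' by typeclasses eauto.
under eq_fun do rewrite /net_integral -sumrB mulr_suml.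
apply: cvg_finsum => e.
have [ar _ _ _] := solution_aeu e tT'.
have ar' := aeu_filter (within_sub_dnbhs tT) ar.
have [nr ir _] : L1c t^' (len e) (fun s => rho s e) (rho t e).
  exact: aeu_L1c (len_gt0 e) ar'.
have q := C1_Loo_aeu tT e c1rho.
have h : L1c t^' (len e) (fun s x => (rho s e x - rho t e x) * (s - t)^-1) (drho t e).
  exact: aeu_L1c (len_gt0 e) q.
apply: cvg_trans (L1c_int h); apply: near_eq_cvg; near=> s.
have rs : integ (len e) (rho s e) by near: s.
by rewrite -RintegralB// -RintegralZr//; exact: integB.
Unshelve. all: by end_near. Qed.

Lemma energy_derivative t : 0 < t < T ->
  (energy c gamma (rho s) (m s) - energy c gamma (rho t) (m t)) * (s - t)^-1 @[s --> t^'] -->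
  - dissipation a b (rho t) (m t).
Proof.
move=> tT; have [t0 tltT] := andP tT.
have tT' : t \in `[0, T] by rewrite in_itv/= !ltW.
have ftT : 0 < t <= T by rewrite t0 ltW.
have [_ [hdrho _] _] := c1rho; have [_ [hdm _] _] := c1m.
rewrite -(energy_rate g1 (c0rho.1 t tT') (c0m.1 t tT') (hdrho t tT') (hdm t tT') (feq ftT)).
have FF : ProperFilter t^' by typeclasses eauto.
under eq_fun do rewrite /energy /net_integral -sumrB mulr_suml.
apply: cvg_finsum => e.
have [ar am _ [r r0 rr]] := solution_aeu e tT'.
apply: edge_energy_derivative r0 _ _ rr _ _.
- exact: len_gt0.
- exact: aeu_filter (within_sub_dnbhs tT) ar.
- exact: aeu_filter (within_sub_dnbhs tT) am.
- exact: (C1_Loo_aeu tT e c1rho).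
- exact: (C1_L2_L1c tT e c1m).
Qed.

End smooth_solutions.

Theorem lemma3p3 (R : realType) (G : network R) (a b c : edge G -> R)
    (gamma T : R) (rho m : R -> netfun G) (rho0 m0 : netfun G)
    (ha : forall e, 0 <= a e) (hb : forall e, 0 <= b e)
    (hc : forall e, 0 < c e) (hgamma : 1 < gamma) (hT : 0 < T)
    (hrho0 : in_H1plus rho0) (hm0 : in_H2 m0)
    (hsol : smooth_solution a b c gamma T rho m)
    (hrho_init : net_ae (fun e x => rho 0 e x = rho0 e x))
    (hm_init : net_ae (fun e x => m 0 e x = m0 e x)) :
  forall t, 0 <= t <= T ->
    net_integral (rho t) = net_integral rho0 /\
    energy c gamma (rho t) (m t) +
      (\int[lebesgue_measure]_(s in `[0%R, t]) dissipation a b (rho s) (m s))%R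
      = energy c gamma rho0 m0.
Proof.
move=> t tT.
have [drho [dm [c1rho c1m c0rho c0m feq]]] := hsol.
have T0 : (0 : R) \in `[0, T] by rewrite in_itv/= lexx ltW.
have [h1 _] := c0rho.1 0 T0; have [h2 _] := c0m.1 0 T0.
have [h3 _] := hrho0; have [h4 _] := hm0.
split.
- have -> : net_integral rho0 = net_integral (rho 0).
    apply: eq_bigr => e _; have /aeIP E := hrho_init e.
    apply: eq_ae_int; [exact: (in_H1_h1 e h3).1|exact: (in_H1_h1 e h1).1|].
    by apply: aeI_imp E => x _ ->.
  have <- := @ftc_balance R T (fun s => net_integral (rho s)) (fun=> 0)
    (mass_cvg c1rho c0rho c0m) (fun _ _ => cvg_cst _) (mass_derivative c1rho c0rho c0m feq) t tT.
  by rewrite Rintegral_cst// mul0r addr0.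
- rewrite -(energy_ext c gamma h1 h2 h3 h4 hrho_init hm_init).
  apply: (@ftc_balance R T (fun s => energy c gamma (rho s) (m s))
    (fun s => dissipation a b (rho s) (m s)) _ _ _ t tT) => s sT.
  + exact: energy_cvg c1rho c0rho c0m _ sT.
  + exact: dissipation_cvg c1rho c0rho c0m _ sT.
  + exact: energy_derivative hgamma c1rho c1m c0rho c0m feq _ sT.
Qed.
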